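(* Let $X$ be a random vector in $\mathbb{R}^d$, $d \ge 1$. (a) Suppose that for every hyperplane $L$ in $\mathbb{R}^d$ supporting $C_X$ and such that $0 < \mathbb{P}(X \in L) < 1$, we have $\mathrm{Pr}_L(\operatorname{rint} \mathcal{D}(K_X)) = \mathrm{Pr}_L(\operatorname{rint} \mathcal{D}(K_{X|L}))$. Then $$\mathcal{F}^*(\mathcal{D}(I_X)) \subset \{\mathcal{D}(I_{X|C}) : C \in \mathcal{F}^*_+(C_X)\} \subset \mathcal{F}(\mathcal{D}(I_X)) \setminus \{\mathcal{D}(I_X)\}.$$ (b) $I_X$ is strictly convex if and only if $\operatorname{int} \mathcal{D}(K_X) \neq \varnothing$, $K_X$ has the projection property, and $K_X$ is totally steep.
   Context: For a random vector $Y$ in $\mathbb{R}^d$: $K_Y(u) := \log \mathbb{E} e^{u \cdot Y} \in (-\infty, +\infty]$ for $u \in \mathbb{R}^d$; the rate function is $I_Y(v) := \sup_{u \in \mathbb{R}^d} (u \cdot v - K_Y(u)) \in [0, +\infty]$. For $f:\mathbb{R}^d \to (-\infty, +\infty]$, $\mathcal{D}(f) := \{u : f(u) < +\infty\}$. $\operatorname{rint} A$ is the interior of $A$ in the relative topology of its affine hull. $\operatorname{supp} Y$ is the smallest closed set $S$ with $\mathbb{P}(Y \in S) = 1$, and $C_Y := \operatorname{conv}(\operatorname{supp} Y)$ (not necessarily closed). Hyperplanes are affine; a hyperplane $L$ supports a convex set $C$ if $L \cap C \neq \varnothing$ and $C$ is contained in one of the two closed half-spaces bounded by $L$ ($C \subset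 L$ is allowed). $\mathrm{Pr}_L$ is the orthogonal projection of $\mathbb{R}^d$ onto $L$. For a Borel set $A$ with $\mathbb{P}(Y \in A) > 0$, $Y|A$ is a random vector distributed as $Y$ conditioned on $\{Y \in A\}$. Faces: a face of a non-empty convex set $C \subset \mathbb{R}^d$ is a convex subset $C'$ of $C$ such that every closed line segment in $C$ with a relative interior point in $C'$ has both endpoints in $C'$ ($C$ itself is a face). $\mathcal{F}(C)$ is the set of non-empty faces of $C$, and $\mathcal{F}^*(C)$ is the set of maximal proper faces: those $C' \in \mathcal{F}(C) \setminus \{C\}$ such that $C' \not\subset C''$ for every $C'' \in \mathcal{F}(C) \setminus \{C, C'\}$. Put $\mathcal{F}^*_+(C_Y) := \{C \in \mathcal{F}^*(C_Y) : \mathbb{P}(Y \in C) > 0\}$ (every $C \in \mathcal{F}^*(C_Y)$ is Borel). Strict convexity: $I_X$ is strictly convex if it is affine on no (non-degenerate) line segment contained in $\mathcal{D}(I_X)$. Projection property (defined by recursion in $\dim C_X$, using $\dim C_{X|C} < \dim C_X$ for $C \in \mathcal{F}^*_+(C_X)$): $K_X$ has the projection property if (i) for every hyperplane $L$ in $\mathbb{R}^d$ supporting $C_X$ with $0 < \mathbb{P}(X \in L) < 1$, $\mathrm{Pr}_L(\operatorname{rint} \mathcal{D}(K_X)) = \mathrm{Pr}_L(\operatorname{rint} \mathcal{D}(K_{X|L}))$; and (ii) $K_{X|C}$ has the projection property for every $C \in \mathcal{F}^*_+(C_X)$. (This is a property of the distribution of $X$. Both conditions hold vacuously when $\mathcal{F}^*_+(C_X)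 = \varnothing$, in particular when $X$ is a.s. constant.) Steepness: $K_X$ is differentiable on $\operatorname{int} \mathcal{D}(K_X)$. When $\operatorname{int} \mathcal{D}(K_X) \neq \varnothing$, $K_X$ is steep if $\lim_{n \to \infty} |\nabla K_X(u_n)| = \infty$ for every sequence $(u_n)$ in $\operatorname{int} \mathcal{D}(K_X)$ converging to a point of $\partial \mathcal{D}(K_X)$ (so $K_X$ is steep if $\mathcal{D}(K_X) = \mathbb{R}^d$). Total steepness (by recursion in $\dim C_X$): when $\operatorname{int} \mathcal{D}(K_X) \neq \varnothing$, $K_X$ is totally steep if $K_X$ is steep and $K_{X|C}$ is totally steep for every $C \in \mathcal{F}^*_+(C_X)$ (here $\mathcal{D}(K_X) \subset \mathcal{D}(K_{X|C})$, so $\operatorname{int} \mathcal{D}(K_{X|C}) \neq \varnothing$). *)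

(* Defs.v *)
From HB Require Import structures.
From mathcomp Require Import all_boot all_order all_algebra.
From mathcomp Require Import all_classical all_reals all_analysis.

Set Implicit Arguments.
Unset Strict Implicit.
Unset Printing Implicit Defensive.

Import Order.TTheory GRing.Theory Num.Theory.
Import numFieldNormedType.Exports.

Local Open Scope classical_set_scope.
Local Open Scope ring_scope.

(* R^d with its Borel sigma-algebra: this type is convertible to 'rV[R]_d but
   only it carries the measurable structure. *)
Notation borel_rV R d := (g_sigma_algebraType (@open 'rV[R]_d)).

Section Geometry.
Context {R : realType} {d : nat}.
Local Notation V := 'rV[R]_d.
Implicit Types (A C L : set V) (x y u v : V).

Definition dot u v : R := \sum_(i < d) u ord0 i * v ord0 i.

(* the norm that MathComp-Analysis puts on row vectors is the sup norm *)
Definition enorm u : R := Num.sqrt (dot u u).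

Definition lpoint x y (t : R) : V := (1 - t) *: x + t *: y.

Definition segment x y : set V := [set lpoint x y t | t in `[0, 1]].

Definition conv_hull A : set V := smallest (@convex_set R V) A.

Definition affine_set A : Prop :=
  forall x y (t : R), A x -> A y -> A (lpoint x y t).

Definition aff_hull A : set V := smallest affine_set A.

Definition rint A : set V :=
  [set x | aff_hull A x /\ \forall y \near x, aff_hull A y -> A y].

Definition boundary A : set V := closure A `\` A°.

(* [a, b] and [c] are not determined by L: each one of the two closed
   half-spaces bounded by L is allowed *)
Definition supporting_hyperplane C L : Prop :=
  exists (a : V) (b : R),
    [/\ a != 0, L = [set x | dot a x = b], L `&` C !=set0 &
        C `<=` [set x | dot a x <= b] \/ C `<=` [set x | b <= dot a x]].

(* orthogonal projection onto a non-empty affine subspace L *)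
Definition orth_proj L x : V :=
  xget 0 [set p | L p /\ forall q, L q -> dot (x - p) (q - p) = 0].

Definition is_face C (F : set V) : Prop :=
  [/\ @convex_set R V F, F `<=` C &
      forall x y, segment x y `<=` C ->
        forall t : R, 0 < t < 1 -> F (lpoint x y t) -> F x /\ F y].

Definition faces C : set (set V) := [set F | is_face C F /\ F !=set0].

Definition max_faces C : set (set V) :=
  [set F | (faces C `\ C) F /\
           forall G, (faces C `\` [set C; F]) G -> ~ (F `<=` G)].

Definition edom (f : V -> \bar R) : set V := [set u | (f u < +oo)%E].

Definition affine_on_segment (f : V -> \bar R) x y : Prop :=
  forall t : R, 0 <= t <= 1 ->
    f (lpoint x y t) = ((1 - t)%:E * f x + t%:E * f y)%E.

Definition strictly_convex (f : V -> \bar R) : Prop :=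
  forall x y, x != y -> segment x y `<=` edom f -> ~ affine_on_segment f x y.

Definition grad (f : V -> R) u : V := \row_(i < d) 'D_(delta_mx ord0 i) f u.

End Geometry.

Section Laws.
Context {R : realType} {d : nat}.
Local Notation V := 'rV[R]_d.
Local Notation law := (probability (borel_rV R d) R).
Implicit Types (mu : law) (A C L : set V) (u v : V).

(* cumulant generating function K_Y of a random vector Y with law mu *)
Definition cgf mu u : \bar R := lne 'E_mu[fun y => expR (dot u y)].

(* rate function I_Y *)
Definition rate mu v : \bar R :=
  ereal_sup [set ((dot u v)%:E - cgf mu u)%E | u in [set: V]].

Definition supp mu : set V :=
  \bigcap_(S in [set S : set V | closed S /\ mu S = 1%E]) S.

(* C_Y *)
Definition csupp mu : set V := conv_hull (supp mu).

(* The law mu( . `&` A) / mu A of Y | A for A Borel with mu A > 0; the other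
   values of A are irrelevant and sent to mu. *)
Definition cond_law mu A : law :=
  match pselect (measurable (A : set (borel_rV R d))) with
  | left mA => mnormalize (mrestr mu mA) mu
  | right _ => mu
  end.

Definition pos_max_faces mu : set (set V) :=
  [set C | max_faces (csupp mu) C /\ (0 < mu C)%E].

Definition hyperplane_projection mu : Prop :=
  forall L, supporting_hyperplane (csupp mu) L -> (0 < mu L < 1)%E ->
    orth_proj L @` rint (edom (cgf mu)) =
    orth_proj L @` rint (edom (cgf (cond_law mu L))).

(* The recursion is on the dimension of csupp mu, which drops from mu to
   cond_law mu C; it is therefore well founded, and the least fixed point is
   its unique solution.  The same remark applies to totally_steep. *)
Inductive projection_property mu : Prop :=
  ProjectionProperty of
    hyperplane_projection mu &
    (forall C, pos_max_faces mu C -> projection_property (cond_law mu C)).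

(* meaningful when (edom (cgf mu))° !=set0; cgf mu is finite there, so that
   fine does not alter its values *)
Definition steep mu : Prop :=
  forall (u : nat -> V) (p : V),
    (forall k, (edom (cgf mu))° (u k)) ->
    boundary (edom (cgf mu)) p ->
    u @ \oo --> p ->
    enorm (grad (fine \o cgf mu) (u k)) @[k --> \oo] --> +oo.

Inductive totally_steep mu : Prop :=
  TotallySteep of
    steep mu &
    (forall C, pos_max_faces mu C -> totally_steep (cond_law mu C)).

End Laws.

(* Main.v *)
(** Let K and I be the cumulant generating function and the rate function of X.
    Jensen's inequality for the laws with density proportional to exp(u.y) on a
    bounded set shows that K is in turn the convex conjugate of I.

    Let L = {a.x = b} bound a half-space {a.x <= b} of probability 1.  Letting t
    tend to infinity in E exp(u.X + t(a.X - b)) shows that on L the function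
    I + log P(L) is the conjugate of the restriction of K_{X|L} to D(K) + Ra; in
    particular I is infinite on L if P(L) = 0.  The projection condition makes
    this restriction harmless, so that I = I_{X|L} - log P(L) on L.  A face F of
    a convex set C is cut out by a supporting hyperplane, because F and C \ F
    are disjoint convex sets and can be properly separated; this gives (a).

    Suppose that I is affine on a segment.  Separating the epigraph of I from
    its point above the midpoint yields either a subgradient u of I at the
    midpoint or a hyperplane that properly supports D(I) there.  In the first
    case the endpoints are two subgradients of K at u, which is excluded by
    differentiability if u is interior to D(K) and by steepness otherwise; in
    the second case the segment is inherited by X|C for a maximal face C.

    Conversely, if K has a subgradient g at a boundary point of D(K) with outer
    normal n, then I is affine on [g, g + n].  A failure of steepness provides
    such a point, and a failure of the projection property provides one for
    K_{X|L} and the set D(K) + Ra. *)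

Require Import Defs.
From HB Require Import structures.
From mathcomp Require Import all_boot all_order all_algebra.
From mathcomp Require Import all_classical all_reals all_analysis.
From mathcomp Require Import measurable_realfun ring lra.

Set Implicit Arguments.
Unset Strict Implicit.
Unset Printing Implicit Defensive.

Import Order.TTheory GRing.Theory Num.Theory.
Import numFieldNormedType.Exports.

Local Open Scope classical_set_scope.
Local Open Scope ring_scope.

(** * Inner product and convex combinations *)

Section DotProduct.
Context {R : realType} {d : nat}.
Local Notation V := 'rV[R]_d.
Implicit Types (A C L M : set V) (x y u v a : V) (s t : R).

Lemma dotC u v : dot u v = dot v u.
Proof. by apply: eq_bigr => i _; rewrite mulrC. Qed.

Lemma dotDl u v x : dot (u + v) x = dot u x + dot v x.
Proof. by rewrite -big_split; apply: eq_bigr => i _; rewrite mxE mulrDl. Qed.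

Lemma dotZl t u x : dot (t *: u) x = t * dot u x.
Proof. by rewrite mulr_sumr; apply: eq_bigr => i _; rewrite mxE mulrA. Qed.

Lemma dotNl u x : dot (- u) x = - dot u x.
Proof. by rewrite -scaleN1r dotZl mulN1r. Qed.

Lemma dotBl u v x : dot (u - v) x = dot u x - dot v x.
Proof. by rewrite dotDl dotNl. Qed.

Lemma dotDr u v x : dot x (u + v) = dot x u + dot x v.
Proof. by rewrite dotC dotDl !(dotC x). Qed.

Lemma dotZr t u x : dot x (t *: u) = t * dot x u.
Proof. by rewrite dotC dotZl (dotC x). Qed.

Lemma dotNr u x : dot x (- u) = - dot x u.
Proof. by rewrite dotC dotNl (dotC x). Qed.

Lemma dotBr u v x : dot x (u - v) = dot x u - dot x v.
Proof. by rewrite dotDr dotNr. Qed.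

Lemma dot0l x : dot 0 x = 0.
Proof. by rewrite -(scale0r 0) dotZl mul0r. Qed.

Lemma dot0r x : dot x 0 = 0.
Proof. by rewrite dotC dot0l. Qed.

Definition dotE := (dotDl, dotDr, dotBl, dotBr, dotZl, dotZr, dotNl, dotNr, dot0l, dot0r).

Lemma dot_ge0 x : 0 <= dot x x.
Proof. by apply: sumr_ge0 => i _; rewrite -expr2 sqr_ge0. Qed.

Lemma dot_eq0 x : (dot x x == 0) = (x == 0).
Proof.
apply/idP/eqP => [|->]; last by rewrite dot0l.
rewrite psumr_eq0 => [/allP x0|i _]; last by rewrite -expr2 sqr_ge0.
apply/rowP => i; rewrite mxE.
by have := x0 i (mem_index_enum _); rewrite -expr2 sqrf_eq0 => /eqP.
Qed.

Lemma dot_gt0 x : (0 < dot x x) = (x != 0).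
Proof. by rewrite lt_def dot_ge0 andbT dot_eq0. Qed.

Lemma dot_delta x (i : 'I_d) : dot x (delta_mx ord0 i) = x ord0 i.
Proof.
rewrite /dot (bigD1 i)//= mxE !eqxx mulr1 big1 ?addr0// => j ji.
by rewrite mxE (negbTE ji) andbF mulr0.
Qed.

Lemma enorm_coord x (i : 'I_d) : `|x ord0 i| <= enorm x.
Proof.
rewrite -sqrtr_sqr ler_wsqrtr// /dot (bigD1 i)//= -expr2 lerDl.
by apply: sumr_ge0 => j _; rewrite -expr2 sqr_ge0.
Qed.

Lemma norm_coord x (i : 'I_d) : `|x ord0 i| <= `|x|.
Proof.
rewrite [leRHS]/Num.norm/= mx_normrE.
exact: (@le_bigmax _ _ _ _ (fun ij => `|x ij.1 ij.2|) (ord0, i)).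
Qed.

Lemma norm_rowP x t : 0 <= t -> (forall i, `|x ord0 i| <= t) -> `|x| <= t.
Proof.
move=> t0 xt; rewrite [leLHS]/Num.norm/= mx_normrE; apply/bigmax_leP; split=> //.
by move=> [i j] _ /=; rewrite (ord1 i).
Qed.

Lemma dot_continuous (T : topologicalType) (f g : T -> V) (z : T) :
  {for z, continuous f} -> {for z, continuous g} ->
  {for z, continuous (fun p => dot (f p) (g p))}.
Proof.
move=> cf cg; rewrite /dot; apply: cvg_big => //; first exact: add_continuous.
move=> i _; have cM : {for _, continuous (fun M : V => M ord0 i)}.
  by move=> M; exact: coord_continuous.
by apply: cvgM; [exact: (cvg_comp _ _ cf (cM _))|exact: (cvg_comp _ _ cg (cM _))].
Qed.

Lemma dotr_continuous a : continuous (dot a : V -> R).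
Proof. move=> x; apply: (@dot_continuous _ (cst a) id); first exact: cst_continuous.
exact: cvg_id. Qed.

Lemma lpoint_continuous (T : topologicalType) (f g : T -> V) (h : T -> R) (z : T) :
  {for z, continuous f} -> {for z, continuous g} -> {for z, continuous h} ->
  {for z, continuous (fun p => lpoint (f p) (g p) (h p))}.
Proof.
move=> cf cg ch; apply: cvgD; last exact: cvgZ.
by apply: cvgZ => //; apply: cvgB => //; exact: cvg_cst.
Qed.

Lemma dot_lpoint a x y t : dot a (lpoint x y t) = (1 - t) * dot a x + t * dot a y.
Proof. by rewrite dotDr !dotZr. Qed.

Lemma lpoint0 x y : lpoint x y 0 = x.
Proof. by rewrite /lpoint subr0 scale1r scale0r addr0. Qed.

Lemma lpoint1 x y : lpoint x y 1 = y.
Proof. by rewrite /lpoint subrr scale0r scale1r add0r. Qed.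

Lemma lpointxx x t : lpoint x x t = x.
Proof. by rewrite /lpoint -scalerDl subrK scale1r. Qed.

Lemma convexP A : @convex_set R V A <->
  forall x y t, 0 <= t <= 1 -> A x -> A y -> A (lpoint x y t).
Proof.
split=> cA x y t.
  move=> /andP[t0 t1] Ax Ay; have := cA y x (Itv01 t0 t1).
  by rewrite !inE => /(_ Ay Ax); rewrite /lpoint addrC.
rewrite !inE => Ax Ay; have : A (lpoint y x t%:num).
  by apply: cA => //; apply/andP; split.
by rewrite /lpoint addrC.
Qed.

End DotProduct.

(** * Proper separation *)

Section Separation.
Context {R : realType} {d : nat}.
Local Notation V := 'rV[R]_d.
Implicit Types (A C L M : set V) (x y u v a : V) (s t : R).

Lemma nearest_point A : A !=set0 -> compact A -> @convex_set R V A ->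
  exists2 z, A z & forall x, A x -> dot z z <= dot z x.
Proof.
move=> A0 cA /convexP vA.
have [|z] := @compact_EVT_min V R (fun x => dot x x) A A0 cA.
  by apply: continuous_subspaceT => x; apply: (@dot_continuous _ _ _ id id); exact: cvg_id.
rewrite inE => Az zmin; exists z => // x Ax; rewrite leNgt; apply/negP => zx.
set e := dot z z - dot z x; have e0 : 0 < e by rewrite subr_gt0.
set q := dot (x - z) (x - z); have q0 : 0 <= q by exact: dot_ge0.
have qe : 0 < q + e by rewrite ltr_wpDl.
(* At [z + t (x - z)] the squared norm is [dot z z - 2 t e + t^2 q]; the choice [t = e / (q + e)]
   gives [t q < e], so this falls below the minimum. *)
have t01 : 0 <= e / (q + e) <= 1.
  by rewrite (divr_ge0 (ltW e0) (ltW qe))/= ler_pdivrMr// mul1r lerDr.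
have := zmin (lpoint z x (e / (q + e))); rewrite inE => /(_ (vA _ _ _ t01 Az Ax)).
set t := e / (q + e).
have -> : lpoint z x t = z + t *: (x - z).
  by rewrite /lpoint scalerBr scalerBl scale1r -addrA (addrC (- _)).
rewrite !dotE (dotC x z) -[dot x x](addrK (dot z z - dot z x *+ 2)).
have -> : dot x x + (dot z z - dot z x *+ 2) = q.
  by rewrite /q !dotE (dotC x z); ring.
have tq : t * q < e.
  by rewrite /t mulrAC ltr_pdivrMr// mulrDr ltrDl mulr_gt0.
have t0 : 0 < t by rewrite divr_gt0.
have te : 0 < t * (2 * e - t * q) by rewrite mulr_gt0//; lra.
rewrite leNgt => /negP; apply; move: te; rewrite /e; nra.
Qed.

Lemma segment_hull_compact A x : compact A ->
  compact [set lpoint x p.1 p.2 | p in A `*` `[0, 1]].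
Proof.
move=> cA; apply: continuous_compact; last first.
  by apply: compact_setX => //; exact: segment_compact.
apply: continuous_subspaceT => p; apply: lpoint_continuous.
- exact: cvg_cst.
- exact: cvg_fst.
- exact: cvg_snd.
Qed.

Lemma segment_hull_convex A x : @convex_set R V A ->
  @convex_set R V [set lpoint x p.1 p.2 | p in A `*` `[0, 1]].
Proof.
move=> /convexP vA; apply/convexP => ? ? r r01.
move=> [[y s] /= [Ay]] + <- [[z t] /= [Az]] + <-; rewrite !in_itv/= => s01 t01.
move: r01 s01 t01 => /andP[r0 r1] /andP[s0 s1] /andP[t0 t1].
(* [c] is the total weight carried by [y] and [z]; grouping them gives a point of [A] joined to [x]
   with parameter [c]. If [c = 0] only [x] remains. *)
set c := (1 - r) * s + r * t.
have c1s0 : 0 <= (1 - r) * s by rewrite mulr_ge0// subr_ge0.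
have c2s0 : 0 <= r * t by rewrite mulr_ge0.
have [c0|c0] := eqVneq c 0.
  have /andP[/eqP c1 /eqP c2] : ((1 - r) * s == 0) && (r * t == 0).
    by rewrite -paddr_eq0// -/c c0.
  exists (y, 0) => /=; first by rewrite in_itv/= lexx ler01.
  rewrite lpoint0 /lpoint !scalerDr !scalerA c1 c2 !scale0r !addr0.
  rewrite !mulrBr !mulr1 c1 c2 !subr0 -scalerDl subrK scale1r//.
exists (lpoint y z (r * t / c), c) => /=.
  have c_gt0 : 0 < c by rewrite lt_def c0 addr_ge0.
  split; last first.
    rewrite in_itv/= addr_ge0//= -[leRHS](subrK r); apply: lerD.
      by rewrite ler_piMr ?subr_ge0.
    by rewrite ler_piMr.
  apply: vA => //; rewrite divr_ge0 ?(ltW c_gt0)//=.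
  by rewrite ler_pdivrMr// mul1r lerDr.
by apply/rowP => i; rewrite !mxE /c; field.
Qed.

(** Supplies the compact set on which [nearest_point] can be used although [M] need not be closed.
    Points are joined one at a time. *)
Lemma finite_hull M x (s : seq V) : @convex_set R V M ->
  (forall y, y \in x :: s -> M y) ->
  exists K, [/\ compact K, @convex_set R V K, K `<=` M &
                forall y, y \in x :: s -> K y].
Proof.
move=> vM; elim: s x => [|y s IH] x Ms.
  exists [set x]; split.
  - exact: compact_set1.
  - by apply/convexP => ? ? t _ -> ->; rewrite lpointxx.
  - by move=> _ ->; apply: Ms; rewrite mem_head.
  - by move=> y; rewrite inE => /eqP ->.
have [z zs|K [cK vK KM Ks]] := IH y; first by apply: Ms; rewrite inE zs orbT.
exists [set lpoint x p.1 p.2 | p in K `*` `[0, 1]]; split.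
- exact: segment_hull_compact.
- exact: segment_hull_convex.
- move=> _ [[z t] /= [Kz t01] <-]; move/convexP: vM; apply=> //; last exact: KM.
  by apply: Ms; rewrite mem_head.
- move=> z; rewrite inE => /orP[/eqP ->|zs].
    by exists (y, 0); rewrite /= ?lpoint0//; split;
      [exact: Ks (mem_head _ _)|rewrite in_itv/= lexx ler01].
  by exists (z, 1); rewrite /= ?lpoint1//; split; [exact: Ks|rewrite in_itv/= lexx ler01].
Qed.

Lemma dot_mulmx n (B : 'M[R]_(d, n)) a (j : 'I_n) :
  (a *m B) ord0 j = dot a (col j B)^T.
Proof. by rewrite mxE; apply: eq_bigr => i _; rewrite !mxE. Qed.

Lemma closed_dot_le a t : closed [set x | dot a x <= t].
Proof.
by apply: (@closed_comp _ _ (dot a) [set z | z <= t]) => [x _|];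
  [exact: dotr_continuous|exact: closed_le].
Qed.

Lemma closed_dot_eq a t : closed [set x | dot a x = t].
Proof.
by apply: (@closed_comp _ _ (dot a) [set z | z = t]) => [x _|];
  [exact: dotr_continuous|exact: closed_eq].
Qed.

Definition unit_sphere (W : 'M[R]_d) : set V := [set a | dot a a = 1 /\ (a <= W)%MS].

Lemma unit_sphere_compact W : compact (unit_sphere W).
Proof.
apply: bounded_closed_compact.
  exists 1; split=> // t t1 a [a1 _]; apply: norm_rowP => [|i].
    by rewrite ltW// (lt_trans ltr01).
  by rewrite (le_trans (enorm_coord _ _))// /enorm a1 sqrtr1 ltW.
have -> : unit_sphere W = [set a | dot a a = 1] `&`
    \bigcap_(j in [set: 'I_d]) [set a | dot (col j (cokermx W))^T a = 0].
  apply/seteqP; split=> a /= [a1].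
    by rewrite submxE => /eqP aW; split=> // j _; rewrite /= dotC -dot_mulmx aW mxE.
  move=> aW; split=> //; rewrite submxE; apply/eqP/rowP => j.
  by rewrite dot_mulmx dotC aW// mxE.
apply: closedI; last by apply: closed_bigI => j _; exact: closed_dot_eq.
apply: (@closed_comp _ _ (fun a => dot a a) [set z | z = 1]) => [x _|]; last exact: closed_eq.
by apply: (@dot_continuous _ _ _ id id); exact: cvg_id.
Qed.

(** Each [m] in [M] allows a closed set of unit vectors [a] in the row space of [W]. For finitely
    many [m], the opposite of the point nearest to 0 in a compact convex set containing them, once
    normalised, is allowed by all; compactness of the sphere does the rest. *)
Lemma weak_separation (W : 'M[R]_d) M : @convex_set R V M -> M !=set0 -> ~ M 0 ->
  (forall m, M m -> (m <= W)%MS) ->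
  exists a, [/\ a != 0, (a <= W)%MS & forall m, M m -> dot a m <= 0].
Proof.
move=> vM [m0 Mm0] M0 MW.
suff [a aM] : \bigcap_(m in M) (unit_sphere W `&` [set a | dot m a <= 0]) !=set0.
  have [[a1 aW] _] := aM _ Mm0; exists a; split=> //.
    by rewrite -dot_eq0 a1 oner_eq0.
  by move=> m /aM[_ /=]; rewrite dotC.
have := @unit_sphere_compact W; rewrite compact_In0; apply.
  by exists (fun m => [set a | dot m a <= 0]) => // m _; exact: closed_dot_le.
move=> D' D'M; have [y|K [cK vK KM Ks]] := @finite_hull M m0 (finmap.enum_fset D') vM.
  by rewrite inE => /orP[/eqP ->//|/D'M]; rewrite inE.
have [|z Kz zmin] := nearest_point _ cK vK; first by exists m0; apply: Ks; rewrite mem_head.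
have z0 : 0 < dot z z.
  by rewrite dot_gt0; apply/eqP => z0; apply: M0; rewrite -z0; exact: KM.
set r := (Num.sqrt (dot z z))^-1.
have r0 : 0 < r by rewrite invr_gt0 sqrtr_gt0.
exists (- r *: z) => m mD'; split; last first.
  rewrite /= dotE mulNr oppr_le0 mulr_ge0 ?ltW// dotC (lt_le_trans z0)// zmin//.
  by apply: Ks; rewrite inE mD' orbT.
split; last by rewrite scalemx_sub// MW//; exact: KM.
by rewrite !dotE mulrA mulrNN -expr2 exprVn sqr_sqrtr ?ltW// mulVf// gt_eqF.
Qed.

(** Induction on the rank of a subspace [W] containing [M]: a weak separator [a] taken in [W] is
    either proper or vanishes on [M], and then [M] lies in the part of [W] orthogonal to [a], of
    smaller rank. *)
Lemma proper_separation M : @convex_set R V M -> M !=set0 -> ~ M 0 ->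
  exists a, (forall m, M m -> dot a m <= 0) /\ exists2 m, M m & dot a m < 0.
Proof.
move=> vM Mn0 M0.
have : forall m, M m -> (m <= (1%:M : 'M[R]_d))%MS by move=> m _; exact: submx1.
move: (1%:M : 'M[R]_d) => W; have [n] := ubnP (\rank W).
elim: n W => // n IH W rW MW.
have [a [a0 aW aM]] := weak_separation vM Mn0 M0 MW.
have [[m [Mm am]]|aM0] := pselect (exists m, M m /\ dot a m < 0).
  by exists a; split=> //; exists m.
apply: (IH (W :&: kermx a^T)%MS) => [|m Mm].
  rewrite ltnS in rW; apply: leq_trans rW; apply: rank_ltmx.
  rewrite ltmxE capmxSl/=; apply: contra a0 => /(submx_trans aW).
  rewrite sub_capmx => /andP[_ /sub_kermxP aa].
  rewrite -dot_eq0; move/matrixP/(_ ord0 ord0): aa; rewrite mxE [RHS]mxE => <-.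
  by apply/eqP/eq_bigr => i _; rewrite mxE.
rewrite sub_capmx MW//=; apply/sub_kermxP/rowP => j; rewrite ord1 mxE [RHS]mxE.
rewrite (eq_bigr (fun i => a ord0 i * m ord0 i)) => [|i _]; last by rewrite mxE mulrC.
by apply/eqP; rewrite eq_le aM//= leNgt; apply/negP => am; apply: aM0; exists m.
Qed.

End Separation.

(** * Relative interiors and faces *)

Lemma sum_continuous {R : realType} (T : topologicalType) n (f : 'I_n -> T -> R) (z : T) :
  (forall i, {for z, continuous (f i)}) ->
  {for z, continuous (fun y => \sum_i f i y)}.
Proof.
by move=> cf; apply: cvg_big => // [|i _]; [exact: add_continuous|exact: cf].
Qed.

(** Replaces the limit [t -> 0] in inequalities obtained along a segment. *)
Lemma le_of_le_addM {R : realType} (x y c : R) :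
  (forall t, 0 < t < 1 -> x <= y + t * c) -> x <= y.
Proof.
move=> xy; rewrite leNgt; apply/negP => yx.
have c0 : 0 <= `|c| by [].
set q := x - y + `|c| + 1; have q0 : 0 < q by rewrite /q; lra.
have /xy : 0 < (x - y) / q < 1.
  by rewrite divr_gt0 ?subr_gt0//= ltr_pdivrMr// mul1r /q; lra.
rewrite -lerBlDl leNgt => /negP; apply.
rewrite mulrAC ltr_pdivrMr// ltr_pM2l ?subr_gt0//.
by have := ler_norm c; rewrite /q; lra.
Qed.

Section ConvexSets.
Context {R : realType} {d : nat}.
Local Notation V := 'rV[R]_d.
Implicit Types (A C D F G L M : set V) (x y u v w a : V) (s t b : R).

Lemma convex_combination C n x (c : 'I_n -> R) (p : 'I_n -> V) :
  @convex_set R V C -> (forall i, 0 <= c i) -> \sum_i c i <= 1 ->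
  C x -> (forall i, C (x + p i)) -> C (x + \sum_i c i *: p i).
Proof.
move=> /convexP vC; elim: n c p => [|n IH] c p c0 c1 Cx Cp.
  by rewrite big_ord0 addr0.
rewrite big_ord_recl; rewrite big_ord_recl in c1.
set q := \sum_(i < n) c (lift ord0 i); rewrite -/q in c1.
have q0 : 0 <= q by exact: sumr_ge0.
have [c01|c01] := eqVneq (c ord0) 1.
  rewrite (eq_bigr (fun=> 0)) => [|i _]; first by rewrite sumr_const mul0rn addr0 c01 scale1r.
  suff -> : c (lift ord0 i) = 0 by rewrite scale0r.
  apply/eqP; rewrite eq_le c0 andbT.
  have : c (lift ord0 i) <= q by rewrite /q (bigD1 i)//= lerDl sumr_ge0.
  by move: c1; rewrite c01; lra.
have c0_lt1 : 0 < 1 - c ord0 by rewrite subr_gt0 lt_neqAle c01/=; lra.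
have -> : x + (c ord0 *: p ord0 + \sum_(i < n) c (lift ord0 i) *: p (lift ord0 i)) =
  lpoint (x + \sum_(i < n) (c (lift ord0 i) / (1 - c ord0)) *: p (lift ord0 i))
         (x + p ord0) (c ord0).
  rewrite /lpoint !scalerDr scaler_sumr [RHS]addrACA -scalerDl subrK scale1r.
  congr (_ + _); rewrite addrC; congr (_ + _); apply: eq_bigr => i _.
  by rewrite scalerA mulrC divfK ?gt_eqF.
apply: vC => //; first by rewrite c0/=; lra.
apply: IH => // [i|]; first exact: divr_ge0 (c0 _) (ltW c0_lt1).
rewrite -mulr_suml ler_pdivrMr// -/q; lra.
Qed.

Lemma interior_line D m v : D° m -> exists2 e, 0 < e & forall t, - e <= t <= e -> D (m + t *: v).
Proof.
rewrite /interior /= => /nbhs_normP[e /= e0 De].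
have v1 : 0 < `|v| + 1 by rewrite ltr_wpDl.
exists (e / (`|v| + 1)); first by rewrite divr_gt0.
move=> t; rewrite -ler_norml => te; apply: De; rewrite /= opprD addrA subrr add0r normrN normrZ.
apply: (@le_lt_trans _ _ (e / (`|v| + 1) * `|v|)); first by rewrite ler_wpM2r.
by rewrite mulrAC ltr_pdivrMr// ltr_pM2l// ltrDl.
Qed.

Lemma row_free_col_mx n (M : 'M[R]_(n, d)) x :
  row_free M -> ~~ (x <= M)%MS -> row_free (col_mx M x).
Proof.
move=> fM xM; have x0 : x != 0 by apply: contraNneq xM => ->; exact: sub0mx.
rewrite /row_free -addsmxE.
have /mxrank_disjoint_sum -> : (M :&: x)%MS = 0; last by rewrite (eqP fM) rank_rV x0.
apply/eqP; rewrite -mxrank_eq0; have := mxrankS (capmxSr M x); rewrite rank_rV x0.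
case E : (\rank _) => [|[|]]// _; case/negP: xM.
apply: (submx_trans _ (capmxSl M x)).
by rewrite -(geq_leqif (mxrank_leqif_sup (capmxSr _ _))) E rank_rV x0.
Qed.

(** Take as many independent vectors as possible whose translates by [x] stay in [C]. Maximality
    confines [C] to the affine space they span, and [C] contains the simplex with these vertices,
    whose barycentre [p] is interior relative to that space. *)
Lemma affine_core C x : @convex_set R V C -> C x ->
  exists (n : nat) (B : 'M[R]_(n, d)), [/\ row_free B,
    forall y, C y -> (y - x <= B)%MS &
    exists2 p, C p & \forall y \near p, (y - x <= B)%MS -> C y].
Proof.
move=> vC Cx.
pose P n := `[< exists B : 'M[R]_(n, d), row_free B /\ forall i, C (x + row i B) >].
have P0 : exists n, P n.
  exists 0%N; apply/asboolP; exists 0; split; last by case.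
  by rewrite /row_free mxrank0.
have Pd n : P n -> (n <= d)%N by move=> /asboolP[B [/eqP rB _]]; rewrite -rB rank_leq_col.
case: (ex_maxnP P0 Pd) => n /asboolP[B [fB CB]] nmax; exists n, B.
have CxB y : C y -> (y - x <= B)%MS.
  move=> Cy; apply: contraT => yB.
  have /nmax : P n.+1; last by rewrite ltnn.
  rewrite -addn1; apply/asboolP; exists (col_mx B (y - x)); split.
    exact: row_free_col_mx.
  move=> i; case: (split_ordP i) => j ->; first by rewrite rowKu.
  by rewrite rowKd row_id addrCA subrr addr0.
have n1 : 0 < n.+1%:R^-1 :> R by rewrite invr_gt0 ltr0n.
pose p : V := x + const_mx n.+1%:R^-1 *m B.
have mulB (c : 'rV[R]_n) : c *m B = \sum_i c ord0 i *: row i B by rewrite mulmx_sum_row.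
have Cc (c : 'rV[R]_n) : (forall i, 0 <= c ord0 i) -> \sum_i c ord0 i <= 1 -> C (x + c *m B).
  by move=> c0 c1; rewrite mulB; exact: convex_combination.
have sum_n : \sum_(i < n) (n.+1%:R^-1 : R) < 1.
  by rewrite sumr_const card_ord -[ltLHS]mulr_natl ltr_pdivrMr ?ltr0n// mul1r ltr_nat.
split=> //; exists p.
  apply: Cc => [i|]; first by rewrite mxE ltW.
  by rewrite (eq_bigr (fun=> n.+1%:R^-1)) => [|i _]; rewrite ?mxE// ltW.
(* The coordinates of [y - x] in the basis [B]: all positive with sum below 1 at [p], hence also
   near [p] by continuity. *)
pose c y := (y - x) *m pinvmx B.
have cp : c p = const_mx n.+1%:R^-1.
  by rewrite /c /p addrAC subrr add0r -mulmxA mulmxVp// mulmx1.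
have cc i : {for p, continuous (fun y => c y ord0 i)}.
  rewrite /c (_ : (fun y => _) = (fun y => dot (y - x) (col i (pinvmx B))^T)); last first.
    by apply/funext => y; rewrite dot_mulmx.
  apply: (@dot_continuous _ _ _ (fun y => y - x) (cst (col i (pinvmx B))^T)).
    exact: (cvgB cvg_id (cvg_cst x)).
  exact: cst_continuous.
have c_gt0 : \forall y \near p, forall i, 0 < c y ord0 i.
  apply: (@filter_forall _ _ (fun i y => 0 < c y ord0 i) _ (nbhs_filter p)) => i.
  by apply: (cvgr_gt _ (cc i)); rewrite cp mxE.
have c_lt1 : \forall y \near p, \sum_i c y ord0 i < 1.
  have sc : (fun y => \sum_i c y ord0 i) @ p --> \sum_i c p ord0 i.
    by apply: (@sum_continuous _ _ _ (fun i y => c y ord0 i)).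
  by apply: (cvgr_lt _ sc); rewrite cp; under eq_bigr do rewrite mxE.
apply: filterS2 c_gt0 c_lt1 => y c0 c1 /mulmxKpV yB.
by rewrite -[y](subrK x) addrC -yB; apply: Cc => [i|]; exact: ltW.
Qed.


Lemma sub_aff_hull C : C `<=` aff_hull C.
Proof. by move=> x Cx A [_]; apply. Qed.

Lemma aff_hull_affine C : affine_set (aff_hull C).
Proof.
by move=> x y t hx hy A CA; have [aA _] := CA; apply: aA; [exact: hx|exact: hy].
Qed.

Lemma rint_nonempty C : @convex_set R V C -> C !=set0 -> rint C !=set0.
Proof.
move=> vC [x Cx]; have [n [B [_ CB [p Cp pB]]]] := affine_core vC Cx.
exists p; split; first exact: sub_aff_hull.
apply: filterS pB => y yC hy; apply: yC.
apply: (hy [set y | (y - x <= B)%MS]); split=> // {y hy} y z t /= yB zB.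
rewrite (_ : _ - x = (1 - t) *: (y - x) + t *: (z - x)).
  by rewrite addmx_sub// scalemx_sub.
by apply/rowP => i; rewrite !mxE; ring.
Qed.

(** If the independent family of [affine_core] spans the space, its inner point is interior to [C];
    otherwise a nonzero vector orthogonal to the family is normal to a hyperplane containing [C]. *)
Lemma interior_or_hyperplane C : @convex_set R V C -> C !=set0 ->
  C° !=set0 \/ exists a b, a != 0 /\ C `<=` [set x | dot a x = b].
Proof.
move=> vC [x Cx]; have [n [B [fB CB [p Cp pB]]]] := affine_core vC Cx.
have [dn|nd] := leqP d n.
  left; exists p; rewrite /interior/=; apply: filterS pB => y; apply.
  apply: submx_full; rewrite /row_full eqn_leq rank_leq_col/=.
  by move/eqP: fB => ->.
right; have : kermx B^T != 0.
  by rewrite -mxrank_eq0 mxrank_ker mxrank_tr subn_eq0 -ltnNge (eqP fB).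
case/rowV0Pn => a /sub_kermxP aB a0; exists a, (dot a x); split=> // y Cy.
have /submxP[c yB] := CB _ Cy.
apply/eqP; rewrite -subr_eq0 -dotBr yB; apply/eqP.
transitivity ((a *m (c *m B)^T) ord0 ord0); last by rewrite trmx_mul mulmxA aB mul0mx mxE.
by rewrite [RHS]mxE; apply: eq_bigr => i _; rewrite [in RHS]mxE.
Qed.

Lemma aff_hull_open C : C° !=set0 -> aff_hull C = setT.
Proof.
move=> [p Cp]; apply/seteqP; split=> // v _.
have [e e0 De] := interior_line (v - p) Cp.
have : aff_hull C (lpoint p (p + e *: (v - p)) e^-1).
  apply: aff_hull_affine; apply: sub_aff_hull; first exact: interior_subset.
  by apply: De; lra.
rewrite (_ : lpoint _ _ _ = v)//; apply/rowP => i; rewrite !mxE; field.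
by rewrite gt_eqF.
Qed.

Lemma rint_interior C : C° !=set0 -> rint C = C°.
Proof.
move=> C0; apply/seteqP; split=> x.
  by case=> _; rewrite aff_hull_open// /interior/=; apply: filterS => y; apply.
move=> Cx; split; first by rewrite aff_hull_open.
by move: Cx; rewrite /interior/=; apply: filterS.
Qed.

Lemma rint_sub C : rint C `<=` C.
Proof. by move=> x [hx] /nbhs_singleton; apply. Qed.

Lemma rint_lpoint C p w t : @convex_set R V C -> rint C p -> C w -> 0 < t <= 1 ->
  rint C (lpoint w p t).
Proof.
move=> /convexP vC rp Cw /andP[t0 t1]; have Cp := rint_sub rp.
case: rp => _ Cnear; split.
  by apply: sub_aff_hull; apply: vC => //; rewrite t1 ltW.
(* The homothety of centre [w] that sends [lpoint w p t] back to [p]; the wanted neighbourhood is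
   the preimage of one of [p]. *)
pose f y := t^-1 *: (y - (1 - t) *: w).
have fK y : lpoint w (f y) t = y.
  by apply/rowP => i; rewrite !mxE; field; rewrite gt_eqF.
have fp : f (lpoint w p t) = p.
  by apply/rowP => i; rewrite !mxE; field; rewrite gt_eqF.
have cf : {for lpoint w p t, continuous f}.
  exact: (cvgZ (cvg_cst _) (cvgB cvg_id (cvg_cst _))).
have /cf : nbhs (f (lpoint w p t)) [set y | aff_hull C y -> C y] by rewrite fp.
apply: (@filterS _ _ (nbhs_filter _)) => y /= Cy hy.
rewrite -(fK y); apply: vC => //; first by rewrite t1 ltW.
apply: Cy; rewrite (_ : f y = lpoint w y t^-1).
  by apply: aff_hull_affine => //; exact: sub_aff_hull.
by apply/rowP => i; rewrite !mxE; field; rewrite gt_eqF.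
Qed.

Lemma segmentP C x y : @convex_set R V C -> C x -> C y -> segment x y `<=` C.
Proof. by move=> /convexP vC Cx Cy _ [t + <-]; rewrite /= in_itv/= => t01; exact: vC. Qed.

Lemma segment_end x y : segment x y x /\ segment x y y.
Proof.
by split; [exists 0|exists 1]; rewrite ?lpoint0 ?lpoint1//= in_itv/= lexx ler01.
Qed.

(** A segment from any [y] in [C] to [x] can be prolonged a little beyond [x] inside [C], and the
    face property at [x] then puts [y] in [F]. *)
Lemma face_rint C F x : @convex_set R V C -> is_face C F -> F x -> rint C x -> F = C.
Proof.
move=> vC [vF FC Fseg] Fx [_ Cnear]; apply/seteqP; split=> // y Cy.
have [e e0 Ne] := @interior_line [set z | aff_hull C z -> C z] x (x - y) Cnear.
have Ce : C (x + e *: (x - y)).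
  apply: Ne; first by lra.
  rewrite (_ : x + _ = lpoint y x (1 + e)); last by apply/rowP => i; rewrite !mxE; ring.
  by apply: aff_hull_affine; apply: sub_aff_hull => //; exact: FC.
have := Fseg _ _ (segmentP vC Cy Ce) (1 + e)^-1.
have e1 : 1 < 1 + e by rewrite ltrDl.
have e20 : 0 < 1 + e by rewrite (lt_trans ltr01).
case=> //; first by rewrite invr_gt0 e20/= invf_lt1.
rewrite (_ : lpoint _ _ _ = x)//; apply/rowP => i; rewrite !mxE; field.
by apply/negP => /eqP; lra.
Qed.

Lemma support_face D a b : @convex_set R V D -> D `<=` [set x | dot a x <= b] ->
  is_face D (D `&` [set x | dot a x = b]).
Proof.
move=> vD Db; split.
- apply/convexP => x y t t01 [Dx /= ax] [Dy /= ay]; split.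
    by move/convexP: vD; apply.
  by rewrite /= dot_lpoint ax ay; ring.
- by move=> x [].
- move=> x y xyD t /andP[t0 t1] [_] /=; rewrite dot_lpoint => axy.
  have [sx sy] := segment_end x y.
  have Dx := xyD _ sx; have Dy := xyD _ sy.
  have /= ax := Db _ Dx; have /= ay := Db _ Dy.
  split; split=> //=; nra.
Qed.

Lemma face_support D F : @convex_set R V D -> is_face D F -> F !=set0 -> F <> D ->
  exists a b, [/\ F `<=` [set x | dot a x = b], D `<=` [set x | dot a x <= b] &
                exists2 w, D w & dot a w < b].
Proof.
move=> vD [vF FD Fseg] [f0 Ff0] FneD.
have [y0 [Dy0 Fy0]] : exists y, D y /\ ~ F y.
  apply: contrapT => h; apply: FneD; apply/seteqP; split=> // y Dy.
  by apply: contrapT => Fy; apply: h; exists y.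
have out f y t : F f -> D y -> ~ F y -> 0 < t < 1 -> D (lpoint f y t) /\ ~ F (lpoint f y t).
  move=> Ff Dy Fy t01; split.
    by move/convexP: vD; apply=> //; [case/andP: t01 => /ltW-> /ltW->|exact: FD].
  by move=> /(Fseg _ _ (segmentP vD (FD _ Ff) Dy) _ t01)[].
(* The complement of a face in [D] is convex, so the differences between it and [F] form a convex
   set that avoids 0. *)
pose M := [set z | exists f y, [/\ F f, D y, ~ F y & z = y - f]].
have [||[f [y [Ff Dy Fy /eqP]]]|a [aM [m [f1 [y1 [Ff1 Dy1 Fy1 ->]]] am]]]
  := @proper_separation R d M.
- apply/convexP => _ _ t t01 [f [y [Ff Dy Fy ->]]] [f' [y' [Ff' Dy' Fy' ->]]].
  exists (lpoint f f' t), (lpoint y y' t); split.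
  + by move/convexP: vF; apply.
  + by move/convexP: vD; apply.
  + have [->|t0] := eqVneq t 0; first by rewrite lpoint0.
    have [->|t1] := eqVneq t 1; first by rewrite lpoint1.
    have {}t01 : 0 < t < 1 by case/andP: t01; rewrite !lt_neqAle eq_sym t0 t1 => -> ->.
    by move=> /(Fseg _ _ (segmentP vD Dy Dy') _ t01)[].
  + by apply/rowP => i; rewrite !mxE; ring.
- by exists (y0 - f0), f0, y0.
- by rewrite eq_sym subr_eq0 => /eqP yf; apply: Fy; rewrite yf.
(* The points of the segment from [f] to [y0], except [f], lie outside [F] and tend to [f]; so [a]
   separates [f] itself from [f']. Exchanging the two makes [a] constant on [F]. *)
have aFle f f' : F f -> F f' -> dot a f <= dot a f'.
  move=> Ff Ff'; apply: (@le_of_le_addM _ _ _ (dot a f - dot a y0)) => t t01.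
  have [Dt Ft] := out _ _ _ Ff Dy0 Fy0 t01.
  have : M (lpoint f y0 t - f') by exists f', (lpoint f y0 t).
  by move=> /aM; rewrite dotBr dot_lpoint; lra.
have aF f : F f -> dot a f = dot a f0 by move=> Ff; apply/eqP; rewrite eq_le !aFle.
exists a, (dot a f0); split=> // [y Dy|].
  rewrite /=; have [/aF ->//|Fy] := pselect (F y).
  have : M (y - f0) by exists f0, y.
  by move=> /aM; rewrite dotBr subr_le0.
by exists y1 => //; move: am; rewrite dotBr (aF _ Ff1) subr_lt0.
Qed.

Lemma max_face_exists C F : @convex_set R V C -> (faces C `\ C) F ->
  exists2 G, max_faces C G & F `<=` G.
Proof.
move=> vC [[fF [f Ff]] FC]; have FsubC : F `<=` C by case: fF.
have [x0 rx0] : rint C !=set0 by apply: rint_nonempty => //; exists f; exact: FsubC.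
(* By [face_rint] the proper faces are those that miss [x0], a condition stable under unions of
   chains. Adjoining [F] makes the empty chain satisfy [P] too. *)
pose P G := is_face C (G `|` F) /\ ~ (G `|` F) x0.
have [|G [[fG Gx0] Gmax]] := @Zorn_bigcup _ P.
  move=> H HP Htot; split; last first.
    move=> [[G HG Gx0]|Fx0]; first by have [_] := HP _ HG; apply; left.
    by apply: FC; exact: face_rint Fx0 rx0.
  have pick x y : (\bigcup_(G in H) G `|` F) x -> (\bigcup_(G in H) G `|` F) y ->
      exists G, [/\ is_face C G, G `<=` (\bigcup_(G in H) G `|` F), G x & G y].
    have base G : H G -> G `|` F `<=` \bigcup_(G in H) G `|` F.
      by move=> HG z [Gz|Fz]; [left; exists G|right].
    move=> [[G HG Gx]|Fx] [[G' HG' Gy]|Fy].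
    - have [GG'|G'G] := Htot _ _ HG HG'.
        exists (G' `|` F); split; [by have [] := HP _ HG'|exact: base|by left;
          exact: GG'|by left].
      exists (G `|` F); split; [by have [] := HP _ HG|exact: base|by left|by left; exact: G'G].
    - exists (G `|` F); split; [by have [] := HP _ HG|exact: base|by left|by right].
    - exists (G' `|` F); split; [by have [] := HP _ HG'|exact: base|by right|by left].
    - by exists F; split=> // z Fz; right.
  split.
  - apply/convexP => x y t t01 Ux Uy; have [G [[/convexP vG _ _] GU Gx Gy]] := pick _ _ Ux Uy.
    by apply: GU; exact: vG.
  - by move=> x Ux; have [G [[_ GC _] _ Gx _]] := pick _ _ Ux Ux; exact: GC.
  - move=> x y xyC t t01 Ux; have [G [[_ _ Gs] GU Gx _]] := pick _ _ Ux Ux.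
    by have [? ?] := Gs _ _ xyC _ t01 Gx; split; exact: GU.
exists (G `|` F); last by move=> x Fx; right.
split; first split.
- by split=> //; exists f; right.
- by move=> GC; apply: Gx0; rewrite GC; exact: rint_sub.
move=> G' [[fG' G'0] /not_orP[G'C G'G]] GG'.
have G'F : G' `|` F = G' by apply/setUidPl => z Fz; apply: GG'; right.
apply: (Gmax G'); last first.
  rewrite /P G'F; split=> // G'x0; apply: G'C; exact: face_rint G'x0 rx0.
split=> [|G'sub]; first by move=> z Gz; apply: GG'; left.
by apply: G'G; apply/seteqP; split=> z; [move=> /G'sub ?; left|exact: GG'].
Qed.

End ConvexSets.

(** * Convex conjugation *)

Section ConvexDuality.
Context {R : realType} {d : nat}.
Local Notation V := 'rV[R]_d.
Implicit Types (C D E G : set V) (x y u v w g a p : V) (s t b c l : R).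

Definition convex_on D (k : V -> R) := forall x y t, 0 <= t <= 1 -> D x -> D y ->
  D (lpoint x y t) /\ k (lpoint x y t) <= (1 - t) * k x + t * k y.

Definition subgradient D (k : V -> R) u g :=
  forall w, D w -> k u + dot g (w - u) <= k w.

(* (E, i) is the convex conjugate of (D, k); a function with values in
   ]-oo, +oo] is a pair of its domain and its finite values. *)
Definition conjugate D (k : V -> R) E (i : V -> R) := forall v c,
  (E v /\ i v <= c) <-> (forall u, D u -> dot u v - k u <= c).

Definition strictly_convex_on E (i : V -> R) := forall x y, x != y ->
  (forall t, 0 <= t <= 1 -> E (lpoint x y t)) ->
  ~ (forall t, 0 <= t <= 1 -> i (lpoint x y t) = (1 - t) * i x + t * i y).

Lemma convex_on_set D k : convex_on D k -> @convex_set R V D.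
Proof. by move=> cv; apply/convexP => x y t t01 Dx Dy; have [] := cv x y t t01 Dx Dy. Qed.

Lemma conjugate_ineq D k E i u v : conjugate D k E i -> D u -> E v ->
  dot u v <= k u + i v.
Proof.
move=> cj Du Ev; have /cj/(_ u Du) : E v /\ i v <= i v by [].
by rewrite lerBlDl.
Qed.

Lemma conjugate_convex D k E i : conjugate D k E i -> convex_on E i.
Proof.
move=> cj x y t /andP[t0 t1] Ex Ey; apply/cj => u Du.
have := conjugate_ineq cj Du Ex; have := conjugate_ineq cj Du Ey.
rewrite dot_lpoint; nra.
Qed.

Lemma conjugate_subgradient D k E i u g : conjugate D k E i -> D u ->
  subgradient D k u g -> E g /\ i g = dot u g - k u.
Proof.
move=> cj Du sg; have [Eg ig] : E g /\ i g <= dot u g - k u.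
  by apply/cj => w Dw; have := sg _ Dw; rewrite dotBr !(dotC g); lra.
split=> //; apply/eqP; rewrite eq_le ig lerBlDl.
exact: conjugate_ineq cj Du Eg.
Qed.

(** The form in which strict convexity is contradicted below: an explicit affine formula on the
    segment from [g] to [g + n]. *)
Lemma strictly_convex_ray E i g n (al be : R) : strictly_convex_on E i -> n != 0 ->
  ~ (forall s, 0 <= s <= 1 -> E (g + s *: n) /\ i (g + s *: n) = al + s * be).
Proof.
move=> sc n0 ray; apply: (sc g (g + n));
  first by rewrite -subr_eq0 opprD addrA subrr add0r oppr_eq0.
  move=> t t01; have [+ _] := ray t t01.
  by congr E; apply/rowP => j; rewrite !mxE; ring.
move=> t t01; have [_] := ray t t01.
have -> : g + t *: n = lpoint g (g + n) t by apply/rowP => j; rewrite !mxE; ring.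
move=> ->.
have [] := ray 0; first by rewrite lexx ler01.
rewrite scale0r addr0 => _ ->.
have [] := ray 1; first by rewrite lexx ler01.
by rewrite scale1r => _ ->; ring.
Qed.

(** If [D] were contained in a hyperplane with normal [a] and level [b], moving [v] by [s *: a]
    would add [s * b] to every [dot u v], so [i] would be affine in the direction [a]. *)
Lemma strictly_convex_interior D k E i : @convex_set R V D -> D !=set0 -> E !=set0 ->
  conjugate D k E i -> strictly_convex_on E i -> D° !=set0.
Proof.
move=> vD D0 [v Ev] cj sc; have [//|[a [b [a0 Dab]]]] := interior_or_hyperplane vD D0.
exfalso; apply: (@strictly_convex_ray _ _ v a (i v) b sc a0) => s s01.
have shift s' v' : E v' -> E (v' + s' *: a) /\ i (v' + s' *: a) <= i v' + s' * b.
  move=> Ev'; apply/cj => u Du; rewrite dotDr dotZr [dot u a]dotC (Dab _ Du).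
  by have := conjugate_ineq cj Du Ev'; lra.
have [Es ies] := shift s _ Ev; split=> //; apply/eqP; rewrite eq_le ies/=.
have [_] := shift (- s) _ Es.
by rewrite scaleNr addrK; lra.
Qed.

(** Separate 0 from the strict epigraph of [k], translated so that the point above [m] is the
    origin. The vertical component [be] of the separating vector is at most 0: if negative,
    rescaling gives a subgradient; if zero, the horizontal component supports [D] at [m]
    properly. *)
Lemma subgradient_or_support D k m : convex_on D k -> D m ->
  (exists g, subgradient D k m g) \/
  exists a, (forall w, D w -> dot a w <= dot a m) /\ exists2 w, D w & dot a w < dot a m.
Proof.
move=> cv Dm.
pose M : set 'rV[R]_(d + 1) := [set z | exists w s,
  [/\ D w, k w - k m < s & z = row_mx (w - m) s%:M]].
have dot_row (z : 'rV[R]_(d + 1)) w s :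
    dot z (row_mx w s%:M) = dot (lsubmx z) w + rsubmx z ord0 ord0 * s.
  rewrite /dot big_split_ord/=; congr (_ + _).
    by apply: eq_bigr => j _; rewrite row_mxEl mxE.
  by rewrite big_ord1 row_mxEr !mxE eqxx mulr1n.
have M0 : ~ M 0.
  case=> w [s [Dw ks]]; rewrite -[0]row_mx0 => /eq_row_mx[/esym/eqP].
  rewrite subr_eq0 => /eqP wm /matrixP/(_ ord0 ord0); rewrite !mxE eqxx mulr1n => s0.
  by move: ks; rewrite wm subrr -s0 ltxx.
have Mn : M !=set0.
  by exists (row_mx (m - m) 1%:M), m, 1; split=> //; rewrite subrr ltr01.
have vM : @convex_set R _ M.
  apply/convexP => _ _ t t01 [w [s [Dw ws ->]]] [w' [s' [Dw' ws' ->]]].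
  have [Dl kl] := cv _ _ _ t01 Dw Dw'.
  exists (lpoint w w' t), ((1 - t) * s + t * s'); split=> //.
    have [t0|t0] := eqVneq t 0.
      by rewrite t0 lpoint0 subr0 mul1r mul0r addr0.
    case/andP: t01 => t_ge0 t1.
    have : 0 < t * (s' - (k w' - k m)) by rewrite mulr_gt0 ?subr_gt0// lt_def t0.
    have : 0 <= (1 - t) * (s - (k w - k m)) by rewrite mulr_ge0 ?subr_ge0// ltW.
    by lra.
  rewrite /lpoint !scale_row_mx add_row_mx; congr row_mx; apply/rowP => j.
    by rewrite !mxE; ring.
  by rewrite !mxE ord1 eqxx !mulr1n.
have [z [zM [zm [w1 [s1 [Dw1 ws1 ->]]] zneg]]] := proper_separation vM Mn M0.
set a := lsubmx z; set be := rsubmx z ord0 ord0.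
have zM' w s : D w -> k w - k m < s -> dot a (w - m) + be * s <= 0.
  by move=> Dw ws; rewrite -dot_row; apply: zM; exists w, s.
have be0 : be <= 0.
  have := zM' m 1 Dm; rewrite !subrr ltr01 dot0r => /(_ isT); lra.
have [be00|bene] := eqVneq be 0.
  right; exists a; split=> [w Dw|].
    have := zM' w (k w - k m + 1) Dw; rewrite ltrDl ltr01 be00 dotBr => /(_ isT); lra.
  by exists w1 => //; move: zneg; rewrite dot_row -/a -/be be00 dotBr; lra.
left; exists (- be^-1 *: a) => w Dw.
have be_lt0 : be < 0 by rewrite lt_neqAle bene.
suff : dot a (w - m) + be * (k w - k m) <= 0.
  rewrite dotZl => H; have : 0 <= be^-1 * (dot a (w - m) + be * (k w - k m)).
    by rewrite mulr_le0// invr_le0.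
  by rewrite mulrDr mulKf//; lra.
apply: (@le_of_le_addM _ _ _ (- be)) => t /andP[t0 _].
by have := zM' w (k w - k m + t) Dw; rewrite ltrDl t0 => /(_ isT); lra.
Qed.

Lemma interior_no_support D m a : D° m -> (forall w, D w -> dot a w <= dot a m) ->
  forall w, dot a w = dot a m.
Proof.
move=> Dm am w; have [e e0 De] := interior_line (w - m) Dm.
have /De/am : - e <= e <= e by lra.
have /De/am : - e <= - e <= e by lra.
rewrite !dotDr !dotZr dotBr => h1 h2; apply/eqP; rewrite -subr_eq0; nra.
Qed.

Lemma interior_subgradient D k m : convex_on D k -> D° m -> exists g, subgradient D k m g.
Proof.
move=> cv Dm; have [//|[a [aD [w Dw]]]] := subgradient_or_support cv (interior_subset Dm).
by rewrite (interior_no_support Dm aD) ltxx.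
Qed.

(** The function [i - dot u] is minimal at the midpoint and its value there is the average of its
    values at the endpoints. So these are minimal too, which is equality in Fenchel's inequality for
    the pairs [(u, x)] and [(u, y)]. *)
Lemma subgradient_of_midpoint D k E i x y u : conjugate D k E i -> conjugate E i D k ->
  E x -> E y -> E (lpoint x y 2^-1) ->
  i (lpoint x y 2^-1) = (1 - 2^-1) * i x + 2^-1 * i y ->
  subgradient E i (lpoint x y 2^-1) u ->
  [/\ D u, subgradient D k u x & subgradient D k u y].
Proof.
set m := lpoint x y _ => cj cj' Ex Ey Em im sg.
have [Du ku] := conjugate_subgradient cj' Em sg.
have := sg _ Ex; have := sg _ Ey; rewrite !dotBr im.
have -> : dot u m = (1 - 2^-1) * dot u x + 2^-1 * dot u y by rewrite dot_lpoint.
move=> iy ix.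
have h z : E z -> i z = dot u z - k u -> subgradient D k u z.
  move=> Ez iz w Dw; have := conjugate_ineq cj Dw Ez.
  by rewrite iz dotBr !(dotC z); lra.
have kuE : k u = (1 - 2^-1) * dot u x + 2^-1 * dot u y - ((1 - 2^-1) * i x + 2^-1 * i y).
  by rewrite ku -im -dot_lpoint dotC.
by split=> //; apply: h => //; rewrite kuE; lra.
Qed.

Lemma interior_lpoint D w p t : @convex_set R V D -> D° p -> D w -> 0 < t <= 1 ->
  D° (lpoint w p t).
Proof.
move=> vD Dp Dw t01; have D0 : D° !=set0 by exists p.
by rewrite -(rint_interior D0); apply: rint_lpoint => //; rewrite rint_interior.
Qed.

Lemma interior_convex D : @convex_set R V D -> @convex_set R V D°.
Proof.
move=> vD; apply/convexP => x y t /andP[t0 t1] Dx Dy.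
have [->|tn0] := eqVneq t 0; first by rewrite lpoint0.
by apply: interior_lpoint => //; [exact: interior_subset|rewrite lt_def tn0 t0].
Qed.

Lemma interior_dense_le D a c p : @convex_set R V D -> D° p ->
  (forall w, D° w -> dot a w <= c) -> forall w, D w -> dot a w <= c.
Proof.
move=> vD Dp ac w Dw; apply: (@le_of_le_addM _ _ _ (dot a w - dot a p)) => t /andP[t0 t1].
have t01 : 0 < t <= 1 by lra.
by have := ac _ (interior_lpoint vD Dp Dw t01); rewrite dot_lpoint; lra.
Qed.

Lemma normal_vector D p : @convex_set R V D -> D° !=set0 -> ~ D° p ->
  exists2 n, n != 0 & forall w, D w -> dot n w <= dot n p.
Proof.
move=> vD [p0 Dp0] Dp.
have [|||n [nM [m [w1 Dw1 <-] nm]]] := @proper_separation R d [set w - p | w in D°].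
- apply/convexP => _ _ t t01 [w Dw <-] [w' Dw' <-]; exists (lpoint w w' t).
    by have /convexP := interior_convex vD; apply.
  by apply/rowP => j; rewrite !mxE; ring.
- by exists (p0 - p), p0.
- by case=> w Dw /eqP; rewrite subr_eq0 => /eqP wp; apply: Dp; rewrite -wp.
exists n; first by apply: contraTneq nm => ->; rewrite dot0l ltxx.
apply: interior_dense_le Dp0 _ => // w Dw; rewrite -subr_le0 -dotBr.
by apply: nM; exists w.
Qed.


Lemma enorm_le g b : (forall j, `|g ord0 j| <= b) -> enorm g <= Num.sqrt (\sum_(j < d) b ^+ 2).
Proof.
move=> gb; apply: ler_wsqrtr; apply: ler_sum => j _.
have := gb j; rewrite -expr2 -(real_normK (num_real (g ord0 j))) => gbj.
by rewrite lerXn2r// nnegrE// (le_trans _ gbj).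
Qed.

(** A subgradient at [u], possibly a boundary point, keeps the subgradients bounded on the way from
    [w0] to [u]; this is what steepness forbids. Each coordinate of [g] is bounded by testing [g] at
    [w0] shifted both ways along the axis. *)
Lemma subgradient_bound D k w0 u x : convex_on D k -> D° w0 -> D u -> subgradient D k u x ->
  exists B, forall t g, 0 < t <= 1 -> subgradient D k (lpoint u w0 t) g -> enorm g <= B.
Proof.
move=> cv Dw0 Du sx.
have /choice[e eP] : forall j : 'I_d, exists e, 0 < e /\
    forall t, - e <= t <= e -> D (w0 + t *: (delta_mx ord0 j : V)).
  by move=> j; have [e e0 De] := interior_line (delta_mx ord0 j) Dw0; exists e.
(* The value at [w0] of the affine minorant of [k] defined by [x]. *)
pose c := k u + dot x (w0 - u).
pose be j := (`|k (w0 + e j *: (delta_mx ord0 j : V)) - c| +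
              `|k (w0 + - e j *: (delta_mx ord0 j : V)) - c|) / e j.
have be0 j : 0 <= be j by rewrite divr_ge0 ?addr_ge0//; have [/ltW] := eP j.
exists (Num.sqrt (\sum_(j < d) (\sum_(j < d) be j) ^+ 2)) => t g t01 sg.
apply: enorm_le => j; apply: (@le_trans _ _ (be j)); last first.
  by rewrite (bigD1 j)//= lerDl sumr_ge0.
have [t0 t1] : 0 < t /\ t <= 1 by case/andP: t01.
have [ej De] := eP j.
have Dt : D (lpoint u w0 t) by have [|//] := cv u w0 t _ Du (interior_subset Dw0); lra.
have s1 := sg _ Du; have s2 := sx _ Dt.
have lu : lpoint u w0 t = u + t *: (w0 - u) by apply/rowP => l; rewrite !mxE; ring.
(* Monotonicity of subgradients between [u] and [lpoint u w0 t]. *)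
have gx : dot x (w0 - u) <= dot g (w0 - u).
  rewrite -subr_ge0 -(pmulr_rge0 _ t0); move: s1 s2.
  have -> : u - lpoint u w0 t = - t *: (w0 - u) by rewrite lu opprD addNKr scaleNr.
  have -> : lpoint u w0 t - u = t *: (w0 - u) by rewrite lu addrAC subrr add0r.
  by rewrite !dotZr; lra.
have key r : - e j <= r <= e j -> r * g ord0 j <= k (w0 + r *: (delta_mx ord0 j : V)) - c.
  move=> re; have := sg _ (De _ re).
  have -> : w0 + r *: delta_mx ord0 j - lpoint u w0 t =
      (1 - t) *: (w0 - u) + r *: delta_mx ord0 j.
    by apply/rowP => l; rewrite !mxE; ring.
  rewrite dotDr !dotZr dot_delta /c; move: s2.
  have -> : lpoint u w0 t - u = t *: (w0 - u) by rewrite lu addrAC subrr add0r.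
  rewrite dotZr; nra.
rewrite /be ler_pdivlMr//.
have [k1 k2] : e j * g ord0 j <= `|k (w0 + e j *: (delta_mx ord0 j : V)) - c| /\
   - e j * g ord0 j <= `|k (w0 + - e j *: (delta_mx ord0 j : V)) - c|.
  by split; (apply: le_trans (ler_norm _); apply: key; lra).
have := normr_ge0 (k (w0 + e j *: (delta_mx ord0 j : V)) - c).
have := normr_ge0 (k (w0 + - e j *: (delta_mx ord0 j : V)) - c).
rewrite -[X in _ * X](gtr0_norm ej) -normrM ler_norml; move: k1 k2; lra.
Qed.

(** A cluster point [g0] of the bounded subgradients is a subgradient at [p]. Neither [D p] nor
    continuity of [k] at [p] is given: in the limit [k] is replaced by its affine minorants
    [dot u z - i z], and the second conjugacy recovers [k p] from them. *)
Lemma subgradient_cluster D k E i (u g : nat -> V) p b :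
  conjugate D k E i -> conjugate E i D k -> D !=set0 ->
  (forall j, D (u j)) -> (forall j, subgradient D k (u j) (g j)) ->
  u @ \oo --> p -> (forall n, exists m, (n <= m)%N /\ enorm (g m) <= b) ->
  exists2 g0, D p & subgradient D k p g0.
Proof.
move=> cj cj' [w0 Dw0] Du sg up /choice[f fP].
have fn n : (n <= f n)%N by have [] := fP n.
have fb n : enorm (g (f n)) <= b by have [] := fP n.
have b0 : 0 <= b by apply: le_trans (fb 0%N); rewrite /enorm sqrtr_ge0.
have cB : compact [set x : V | enorm x <= b].
  apply: bounded_closed_compact.
    exists b; split=> [|t bt x /= xb]; first exact: num_real.
    apply: norm_rowP => [|j]; first by rewrite ltW// (le_lt_trans b0).
    by rewrite (le_trans (enorm_coord _ _))// (le_trans xb)// ltW.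
  apply: (@closed_comp _ _ (enorm : V -> R) [set z | z <= b]) => [x _|]; last exact: closed_le.
  apply: (@continuous_comp _ _ _ (fun x : V => dot x x) Num.sqrt); last exact: sqrt_continuous.
  by apply: (@dot_continuous _ _ _ id id); exact: cvg_id.
have [|g0 [_ cl]] := cB ((g \o f) @ \oo) (fmap_proper_filter _ _).
  by exists 0%N => // n _; exact: fb.
have lim w z : D w -> E z -> dot p z - i z + dot g0 (w - p) <= k w.
  move=> Dw Ez; rewrite leNgt; apply/negP => kw.
  have c1 : {for (p, g0 : V), continuous (fun q : V * V => dot q.1 z)}.
    by apply: (@dot_continuous _ _ _ fst (cst z)); [exact: cvg_fst|exact: cst_continuous].
  have c2 : {for (p, g0 : V), continuous (fun q : V * V => dot q.2 w)}.
    by apply: (@dot_continuous _ _ _ snd (cst w)); [exact: cvg_snd|exact: cst_continuous].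
  have c3 : {for (p, g0 : V), continuous (fun q : V * V => dot q.2 q.1)}.
    by apply: (@dot_continuous _ _ _ snd fst); [exact: cvg_snd|exact: cvg_fst].
  have cphi := cvgD (cvgB c1 (cvg_cst (i z))) (cvgB c2 c3).
  rewrite dotBr in kw.
  have [[U W] /= [Up Wg] UW] := cvgr_gt _ (cphi _ _ _ _) _ kw.
  have [N _ HN] := up _ Up.
  have FA : ((g \o f) @ \oo) [set x | exists n, x = g (f n) /\ U (u (f n))].
    exists N => // n /= Nn; exists n; split=> //; apply: HN => /=.
    exact: leq_trans Nn (fn n).
  have [_ [[n [-> Un]] Wn]] := cl _ _ FA Wg.
  have := UW (u (f n), g (f n)) (conj Un Wn); rewrite /= ltNge => /negP; apply.
  change (dot (u (f n)) z - i z + (dot (g (f n)) w - dot (g (f n)) (u (f n))) <= k w).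
  by have := sg (f n) _ Dw; have := conjugate_ineq cj (Du (f n)) Ez; rewrite dotBr; lra.
have bound w : D w -> D p /\ k p <= k w - dot g0 (w - p).
  by move=> Dw; apply/cj' => z Ez; have := lim _ _ Dw Ez; rewrite dotC; lra.
exists g0; first by have [] := bound _ Dw0.
by move=> w Dw; have [_] := bound _ Dw; lra.
Qed.

(** The exit parameter is the supremum of those for which the point lies in [G]; the point there is
    not in [G], since [G] is open along lines. *)
Lemma exit_point G w0 u1 :
  (forall x y t, 0 <= t <= 1 -> G x -> G y -> G (lpoint x y t)) ->
  (forall w v, G w -> exists2 e, 0 < e & forall s, - e <= s <= e -> G (w + s *: v)) ->
  G w0 -> ~ G u1 -> exists2 t, 0 <= t <= 1 & ~ G (lpoint w0 u1 t) /\
    forall s, 0 <= s < 1 -> G (lpoint w0 (lpoint w0 u1 t) s).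
Proof.
move=> vG Gopen Gw0 Gu1.
pose T := [set t | 0 <= t <= 1 /\ G (lpoint w0 u1 t)].
have T0 : T 0 by split; [rewrite lexx ler01|rewrite lpoint0; exact: Gw0].
have T1 : ubound T 1 by move=> t [/andP[]].
have supT : has_sup T by split; [exists 0|exists 1].
set ts := sup T.
have ts0 : 0 <= ts by apply: ub_le_sup => //; exists 1.
have ts1 : ts <= 1 by apply: ge_sup => //; exists 0.
have line s : lpoint w0 (lpoint w0 u1 ts) s = lpoint w0 u1 (s * ts).
  by apply/rowP => j; rewrite !mxE; ring.
have Gts : ~ G (lpoint w0 u1 ts).
  move=> Gt; have tsn1 : ts < 1.
    by rewrite lt_neqAle ts1 andbT; apply/eqP => t1; apply: Gu1; move: Gt; rewrite t1 lpoint1.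
  have [e e0 Ge] := Gopen _ (u1 - w0) Gt.
  pose e' := Num.min e (1 - ts).
  have e'0 : 0 < e' by rewrite lt_min e0 subr_gt0.
  have [e'1 e'2] : e' <= e /\ e' <= 1 - ts by rewrite /e' !ge_min !lexx orbT.
  have : T (ts + e').
    split; first by lra.
    have := Ge e' _; rewrite (_ : lpoint _ _ _ + _ = lpoint w0 u1 (ts + e')).
      by apply; lra.
    by apply/rowP => j; rewrite !mxE; ring.
  by move=> /(ub_le_sup (ex_intro _ 1 T1)); rewrite -/ts; lra.
exists ts; first by rewrite ts0 ts1.
split=> //; move=> s /andP[s0 s1]; rewrite line.
have [tsz|tsn0] := eqVneq ts 0; first by rewrite tsz mulr0 lpoint0; exact: Gw0.
have ts_gt0 : 0 < ts by rewrite lt_def tsn0.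
have [|t [_ Gt] st] := @sup_adherent _ T (ts - s * ts) _ supT.
  by rewrite subr_gt0 gtr_pMl.
rewrite -/ts opprB addrC subrK in st.
have st0 : 0 <= s * ts by rewrite mulr_ge0.
have t0 : 0 < t by lra.
rewrite (_ : lpoint _ _ _ = lpoint w0 (lpoint w0 u1 t) (s * ts / t)).
  apply: vG; last exact: Gt; last exact: Gw0.
  by rewrite divr_ge0 ?(ltW t0)//= ler_pdivrMr// mul1r ltW.
by apply/rowP => j; rewrite !mxE; field; rewrite gt_eqF.
Qed.

(** Here [DA], [kA] stand for the cumulant generating function conditioned on the hyperplane with
    normal [a] and level [b], and [G] for the interior of [D] plus the line spanned by [a]. With [g]
    a subgradient of [kA] at [p] and [n] normal to [G] at [p], the function [i] is affine from [g]
    to [g + n]. *)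
Lemma exit_point_affine D E i DA kA a b l G w0 p :
  convex_on DA kA -> D `<=` DA ->
  (forall u t, DA u -> DA (u + t *: a) /\ kA (u + t *: a) = kA u + t * b) ->
  (forall v, dot a v = b -> forall c,
    (E v /\ i v <= c) <-> (forall u, D u -> dot u v - kA u <= c + l)) ->
  (forall x y t, 0 <= t <= 1 -> G x -> G y -> G (lpoint x y t)) ->
  (forall w, G w -> exists t, D (w + t *: a)) -> (forall w t, G w -> G (w + t *: a)) ->
  G w0 -> ~ G p -> (forall s, 0 <= s < 1 -> G (lpoint w0 p s)) -> DA° p ->
  (forall n, (forall w, G w -> dot n w <= dot n p) -> forall w, D w -> dot n w <= dot n p) ->
  ~ strictly_convex_on E i.
Proof.
move=> cvA DDA shift Eface vG GD Ga Gw0 Gp Gps pu hD sc.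
have [g sg] := interior_subgradient cvA pu.
have {pu}DAp := interior_subset pu.
have DAw0 : DA w0.
  have [t Dt] := GD _ Gw0; have [+ _] := shift _ (- t) (DDA _ Dt).
  by rewrite scaleNr addrK.
(* Since [kA] is affine with slope [b] along [a], its subgradients lie on the hyperplane, where [i]
   is given by [kA]. *)
have ga : dot a g = b.
  have [D1 k1] := shift p 1 DAp; have [D2 k2] := shift p (- 1) DAp.
  have := sg _ D1; have := sg _ D2; rewrite k1 k2 !(addrC p) !addrK !dotZr !(dotC g).
  by move=> h1 h2; apply/eqP; rewrite eq_le; apply/andP; lra.
have [|||n [nM [m [w1 Gw1 <-] nm]]] := @proper_separation R d [set w - p | w in G].
- apply/convexP => _ _ t t01 [w Dw <-] [w' Dw' <-]; exists (lpoint w w' t).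
    exact: vG.
  by apply/rowP => j; rewrite !mxE; ring.
- by exists (w0 - p), w0.
- by case=> w Dw /eqP; rewrite subr_eq0 => /eqP wp; apply: Gp; rewrite -wp.
have n0 : n != 0 by apply: contraTneq nm => ->; rewrite dot0l ltxx.
have nG w : G w -> dot n w <= dot n p.
  by move=> Gw; rewrite -subr_le0 -dotBr; apply: nM; exists w.
have nD := hD _ nG.
(* [G] contains the line through [w0] with direction [a], and [dot n] is bounded above on [G]; the
   chosen parameter would reach [dot n p + 1]. *)
have na : dot a n = 0.
  have Gt t : G (w0 + t *: a) by exact: Ga.
  rewrite dotC; apply: contrapT => /eqP na0.
  have := nG _ (Gt ((dot n p - dot n w0 + 1) / dot n a)).
  by rewrite dotDr dotZr divfK//; lra.
apply: (@strictly_convex_ray E i g n (dot g p - kA p - l) (dot n p) sc n0) => s /andP[s0 s1].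
have gsL : dot a (g + s *: n) = b by rewrite dotDr dotZr na mulr0 addr0.
have [Eg ig] : E (g + s *: n) /\ i (g + s *: n) <= dot g p - kA p - l + s * dot n p.
  apply/(Eface _ gsL) => u Du; have := nD _ Du; have := sg _ (DDA _ Du).
  rewrite dotBr dotDr dotZr !(dotC u); nra.
split=> //; apply/eqP; rewrite eq_le ig/=.
(* The lower bound: the expression is unchanged by moving [w] along [a], so it may be evaluated in
   [D]. It is then carried to [p] along the segment from [w0] by convexity of [kA]. *)
have GE w : G w -> dot w (g + s *: n) - kA w <= i (g + s *: n) + l.
  move=> Gw; have [t Dt] := GD _ Gw; have [_ kt] := shift _ (- t) (DDA _ Dt).
  have := (Eface _ gsL (i (g + s *: n))).1 (conj Eg (lexx _)) _ Dt.
  rewrite dotDl dotZl gsL; move: kt; rewrite scaleNr addrK => ->; lra.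
suff : dot p (g + s *: n) - kA p <= i (g + s *: n) + l.
  by rewrite dotDr dotZr !(dotC p); lra.
pose h w := dot w (g + s *: n) - kA w.
apply: (@le_of_le_addM _ _ _ (h p - h w0)) => t t01.
have [|_ kt] := cvA w0 p (1 - t) _ DAw0 DAp; first by lra.
have /Gps/GE : 0 <= 1 - t < 1 by lra.
rewrite /h dotC dot_lpoint !(dotC _ (g + s *: n)); move: kt.
rewrite opprB addrCA subrr addr0; nra.
Qed.

(** If [u1] could not be moved along [a] into the interior of [D], the segment from [w0] to [u1]
    would leave [G] at a point interior to [DA], as [exit_point_affine] requires. *)
Lemma affine_projection D k E i DA kA a b l :
  convex_on D k -> convex_on DA kA -> D `<=` DA ->
  (forall u t, DA u -> DA (u + t *: a) /\ kA (u + t *: a) = kA u + t * b) ->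
  (forall v, dot a v = b -> forall c,
    (E v /\ i v <= c) <-> (forall u, D u -> dot u v - kA u <= c + l)) ->
  strictly_convex_on E i -> D° !=set0 ->
  forall u, DA° u -> exists t, D° (u + t *: a).
Proof.
move=> cv cvA DDA shift Eface sc [w0 Dw0] u1 DAu1; apply: contrapT => notG.
have vD := convex_on_set cv; have vDA := convex_on_set cvA.
pose G := [set w | exists t, D° (w + t *: a)].
have vDo := (convexP _).1 (interior_convex vD).
have vG x y t : 0 <= t <= 1 -> G x -> G y -> G (lpoint x y t).
  move=> t01 [s Ds] [r Dr]; exists ((1 - t) * s + t * r).
  have -> : lpoint x y t + ((1 - t) * s + t * r) *: a = lpoint (x + s *: a) (y + r *: a) t;
    last exact: vDo t01 Ds Dr.
  by apply/rowP => j; rewrite !mxE; ring.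
have GD w : D° w -> G w by exists 0; rewrite scale0r addr0.
have Gu1 : ~ G u1 by case=> t Dt; apply: notG; exists t.
have Gopen w v : G w -> exists2 e, 0 < e & forall s, - e <= s <= e -> G (w + s *: v).
  move=> [t Dt]; have [e e0 De] := @interior_line _ _ D° (w + t *: a) v (nbhs_interior Dt).
  by exists e => // s se; exists t; rewrite addrAC; exact: De.
have [p [Gp Gps pu]] : exists p, [/\ ~ G p, (forall s, 0 <= s < 1 -> G (lpoint w0 p s))
    & DA° p].
  have [ts ts01 [Gts Gs]] := exit_point vG Gopen (GD _ Dw0) Gu1.
  exists (lpoint w0 u1 ts); split=> //.
  by apply: ((convexP _).1 (interior_convex vDA)) => //;
    exact: (topology_structure.interiorS DDA) Dw0.
apply: (exit_point_affine cvA DDA shift Eface vG _ _ (GD _ Dw0) Gp Gps pu _ sc).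
- by move=> w [t /interior_subset Dt]; exists t.
- by move=> w s [t Dt]; exists (t - s); rewrite -addrA -scalerDl addrCA subrr addr0.
- move=> n nG; apply: (interior_dense_le vD Dw0) => w Dw; apply: nG; exact: GD.
Qed.

(** For [dot a v = b] the concave function [dot w v - kA w] is constant along [a], so a bound on [D]
    extends to the relative interior of [DA], and from there to [DA] along segments. *)
Lemma conjugate_of_projection D E i DA kA a b l :
  convex_on DA kA -> D `<=` DA ->
  (forall u t, DA u -> DA (u + t *: a) /\ kA (u + t *: a) = kA u + t * b) ->
  (forall v, dot a v = b -> forall c,
    (E v /\ i v <= c) <-> (forall u, D u -> dot u v - kA u <= c + l)) ->
  (forall u, rint DA u -> exists t, D (u + t *: a)) ->
  forall v, dot a v = b -> forall c,
    (E v /\ i v <= c) <-> (forall u, DA u -> dot u v - kA u <= c + l).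
Proof.
move=> cvA DDA shift Eface proj v av c; split; last first.
  by move=> H; apply/(Eface _ av) => u /DDA; exact: H.
move=> /(Eface _ av) H u DAu; have vDA := convex_on_set cvA.
have [|r rr] := rint_nonempty vDA; first by exists u.
pose h w := dot w v - kA w.
apply: (@le_of_le_addM _ _ _ (h u - h r)) => t /andP[t0 t1].
have t01 : 0 < t <= 1 by lra.
have rt := rint_lpoint vDA rr DAu t01.
have [s Ds] := proj _ rt; have := H _ Ds.
have [_ ->] := shift _ s (rint_sub rt); rewrite dotDl dotZl av.
have [|_] := cvA u r t _ DAu (rint_sub rr); first by lra.
rewrite (dotC (lpoint u r t)) dot_lpoint /h !(dotC v); lra.
Qed.

End ConvexDuality.

(** * Laplace transforms *)

Section Mgf.
Context {R : realType} {d : nat}.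
Local Notation V := 'rV[R]_d.
Local Notation B := (borel_rV R d).
Local Notation law := (probability (borel_rV R d) R).
Implicit Types (mu : law) (A L : set V) (u v w a x y z : V) (b c s t : R).

Lemma measurable_open A : open A -> measurable (A : set B).
Proof. by move=> oA; apply: sub_sigma_algebra. Qed.

Lemma measurable_closed A : closed A -> measurable (A : set B).
Proof.
move=> cA; rewrite -[A]setCK; apply: measurableC; apply: measurable_open.
exact: closed_openC.
Qed.

Lemma measurable_dot u : measurable_fun [set: B] (dot u : B -> R).
Proof.
apply: (measurability _ (RGenOpens.measurableE R)) => _ [_ [s [t ->] <-]].
rewrite setTI; apply: measurable_open.
by apply: (@open_comp _ _ (dot u : V -> R)) => [x _|];
  [exact: dotr_continuous|exact: interval_open].
Qed.

Lemma measurable_expR_dotr A u : measurable_fun (A : set B) (fun y : B => expR (dot u y)).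
Proof.
apply: measurable_funTS.
exact: (@measurableT_comp _ _ _ B R R expR setT (dot u) (@measurable_expR R) (measurable_dot u)).
Qed.

Lemma measurable_expR_dot A u : measurable_fun (A : set B) (fun y : B => (expR (dot u y))%:E).
Proof. by apply/measurable_EFinP; exact: measurable_expR_dotr. Qed.

Definition mgf mu A u : \bar R := (\int[mu]_(y in (A : set B)) (expR (dot u y))%:E)%E.

Lemma mgf_ge0 mu A u : (0 <= mgf mu A u)%E.
Proof. by apply: integral_ge0 => y _; rewrite lee_fin expR_ge0. Qed.

Lemma mgf_gt0 mu A u : measurable (A : set B) -> (0 < mu A)%E -> (0 < mgf mu A u)%E.
Proof.
move=> mA A0; rewrite lt_def mgf_ge0 andbT; apply: contraTneq A0 => A0.
have : (\int[mu]_(y in (A : set B)) `|(expR (dot u y))%:E| = 0)%E.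
  by rewrite -[RHS]A0; apply: eq_integral => y _; rewrite gee0_abs// lee_fin expR_ge0.
move/(ae_eq_integral_abs mu mA (@measurable_expR_dot A u)) => ae0.
have : mu.-negligible (A : set B).
  rewrite -[A : set B]setCK; apply: (filterS _ ae0) => y h Ay.
  by have /eqP := h Ay; rewrite eqe gt_eqF// expR_gt0.
by move=> /(negligibleP mu mA) ->; rewrite ltxx.
Qed.

Lemma cgfE mu u : cgf mu u = lne (mgf mu setT u).
Proof. by rewrite /cgf unlock. Qed.

Lemma edom_cgf mu u : edom (cgf mu) u <-> (mgf mu setT u < +oo)%E.
Proof.
rewrite /edom/= cgfE; have := @mgf_gt0 mu setT u (@measurableT _ B).
rewrite probability_setT lte01 => /(_ isT).
by case: (mgf _ _ _) => [r|//|//]; rewrite lte_fin => r0; rewrite lne_EFin// !ltry.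
Qed.

Lemma mgfE mu u : edom (cgf mu) u -> mgf mu setT u = (expR (fine (cgf mu u)))%:E.
Proof.
move=> /edom_cgf; have := @mgf_gt0 mu setT u (@measurableT _ B).
rewrite probability_setT lte01 cgfE => /(_ isT).
by case: (mgf _ _ _) => [r|//|//]; rewrite lte_fin => r0 _; rewrite lne_EFin//= lnK.
Qed.

Lemma cgf_fin mu u : edom (cgf mu) u -> cgf mu u = (fine (cgf mu u))%:E.
Proof.
by move=> Du; rewrite {1}cgfE mgfE// lne_EFin ?expR_gt0// expRK.
Qed.

Lemma mgf_le mu u c : (mgf mu setT u <= (expR c)%:E)%E -> edom (cgf mu) u /\ fine (cgf mu u) <= c.
Proof.
move=> uc; have Du : edom (cgf mu) u by apply/edom_cgf; rewrite (le_lt_trans uc)// ltry.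
by split=> //; move: uc; rewrite mgfE// lee_fin ler_expR.
Qed.

Lemma integrable_expR_dot mu u : edom (cgf mu) u ->
  mu.-integrable [set: B] (fun y : B => (expR (dot u y))%:E).
Proof.
move=> /edom_cgf ulty; apply/integrableP; split; first exact: measurable_expR_dot.
rewrite (eq_integral (fun y : B => (expR (dot u y))%:E))// => y _.
by rewrite gee0_abs// lee_fin expR_ge0.
Qed.

Lemma edom_cgf0 mu : edom (cgf mu) 0 /\ fine (cgf mu 0) = 0.
Proof.
have Z0 : mgf mu setT 0 = 1%E.
  rewrite /mgf (eq_integral (cst 1%E)) => [|y _]; last by rewrite dot0l expR0.
  by rewrite integral_cst// mul1e; exact: probability_setT.
split; first by apply/edom_cgf; rewrite Z0 ltry.
by rewrite cgfE Z0 lne1.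
Qed.

Lemma rate_conjugate mu :
  conjugate (edom (cgf mu)) (fine \o cgf mu) (edom (rate mu)) (fine \o rate mu).
Proof.
move=> v c; have rate_le : (rate mu v <= c%:E)%E <->
    (forall u, edom (cgf mu) u -> dot u v - fine (cgf mu u) <= c).
  split=> [H u Du|H].
    have : ((dot u v)%:E - cgf mu u <= rate mu v)%E by apply: ereal_sup_ubound; exists u.
    by rewrite cgf_fin// => /le_trans/(_ H); rewrite -EFinB lee_fin.
  apply: ge_ereal_sup => _ [u _ <-]; have [Du|nDu] := pselect (edom (cgf mu) u).
    by rewrite cgf_fin// -EFinB lee_fin; exact: H.
  have -> : cgf mu u = +oo%E by apply/eqP; move: nDu; rewrite /edom/= ltey => /negP/negPn.
  by rewrite addeNy ?leNye.
have rate_ge0 : (0 <= rate mu v)%E.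
  apply: ereal_sup_ubound; exists 0 => //; have [D0 k0] := edom_cgf0 mu.
  by rewrite cgf_fin// k0 dot0l sube0.
rewrite -rate_le /edom/=; split.
  move=> [Ev]; rewrite -lee_fin fineK// ge0_fin_numE//.
move=> vc; have vlty : (rate mu v < +oo)%E by rewrite (le_lt_trans vc)// ltry.
by split=> //; rewrite -lee_fin fineK// ge0_fin_numE.
Qed.

Lemma rate_ge0 mu v : edom (rate mu) v -> 0 <= fine (rate mu v).
Proof.
move=> Ev; have [D0 k0] := edom_cgf0 mu.
by have := conjugate_ineq (@rate_conjugate mu) D0 Ev; rewrite /= k0 dot0l add0r.
Qed.

End Mgf.

(** * Duality between the cumulant generating function and the rate function *)

Section Biconjugate.
Context {R : realType} {d : nat}.
Local Notation V := 'rV[R]_d.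
Local Notation B := (borel_rV R d).
Local Notation law := (probability (borel_rV R d) R).
Implicit Types (mu : law) (A L : set V) (u v w a h x y z : V) (b c s t : R).

Definition cube (n : nat) : set V := [set y | `|y| <= n%:R].

Lemma measurable_cube n : measurable (cube n : set B).
Proof.
apply: measurable_closed.
apply: (@closed_comp _ _ (Num.norm : V -> R) [set r | r <= n%:R]) => [y _|].
  exact: norm_continuous.
exact: closed_le.
Qed.

Lemma cube_dot n u y : cube n y -> `|dot u y| <= \sum_(i < d) `|u ord0 i| * n%:R.
Proof.
move=> ny; apply: le_trans (ler_norm_sum _ _ _) _; apply: ler_sum => i _.
by rewrite normrM ler_wpM2l// (le_trans (norm_coord _ _)).
Qed.

Lemma integrable_cube mu n u (f : B -> R) (M : R) : measurable_fun [set: B] f ->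
  (forall y, cube n y -> `|f y| <= M) ->
  mu.-integrable (cube n : set B) (EFin \o (fun y : B => f y * expR (dot u y))).
Proof.
move=> mf fM; apply: measurable_bounded_integrable.
- exact: measurable_cube.
- exact: le_lt_trans (probability_le1 _ (measurable_cube n)) (ltry _).
- by apply: measurable_funTS; apply: measurable_funM => //; exact: measurable_expR_dotr.
- exists (M * expR (\sum_(i < d) `|u ord0 i| * n%:R)); split; first exact: num_real.
  move=> r Mr y /= ny; rewrite normrM (gtr0_norm (expR_gt0 _)).
  apply: le_trans (ltW Mr); apply: ler_pM => //; first exact: fM.
  by rewrite ler_expR (le_trans (ler_norm _))// cube_dot.
Qed.

Lemma Rintegral_dot_cube mu n u h (r : seq 'I_d) :
  mu.-integrable (cube n : set B)
    (EFin \o (fun y : B => (\sum_(i <- r) h ord0 i * (y : V) ord0 i) * expR (dot u y))) /\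
  \int[mu]_(y in (cube n : set B)) ((\sum_(i <- r) h ord0 i * (y : V) ord0 i) * expR (dot u y)) =
  \sum_(i <- r) h ord0 i * \int[mu]_(y in (cube n : set B)) ((y : V) ord0 i * expR (dot u y)).
Proof.
have icoord i : mu.-integrable (cube n : set B)
    (EFin \o (fun y : B => (y : V) ord0 i * expR (dot u y))).
  apply: (@integrable_cube _ _ _ _ n%:R) => [|y ny]; last exact: le_trans (norm_coord _ _) ny.
  rewrite (_ : (fun y : B => _) = dot (delta_mx ord0 i)); first exact: measurable_dot.
  by apply/funext => y; rewrite dotC dot_delta.
elim: r => [|i r [IHi IHr]].
  split.
    apply: (@eq_integrable _ _ _ _ _ _ (cst 0%E)); [exact: measurable_cube| |exact: integrable0].
    by move=> y _; rewrite /= big_nil mul0r.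
  rewrite big_nil (@eq_Rintegral _ _ _ mu _ (fun=> 0)) => [|y _]; last by rewrite big_nil mul0r.
  by rewrite Rintegral_cst ?mul0r//; exact: measurable_cube.
have E (y : B) : (\sum_(j <- i :: r) h ord0 j * (y : V) ord0 j) * expR (dot u y) =
    h ord0 i * ((y : V) ord0 i * expR (dot u y)) +
      (\sum_(j <- r) h ord0 j * (y : V) ord0 j) * expR (dot u y).
  by rewrite big_cons mulrDl mulrA.
have ii : mu.-integrable (cube n : set B)
    (EFin \o (fun y : B => h ord0 i * ((y : V) ord0 i * expR (dot u y)))).
  exact: (integrableZl (measurable_cube n) (h ord0 i) (icoord i)).
split.
  apply: (@eq_integrable _ _ _ _ _ _ _ _ _ (integrableD (measurable_cube n) ii IHi)).
    exact: measurable_cube.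
  by move=> y _; rewrite /= -EFinD E.
rewrite (@eq_Rintegral _ _ _ mu _ _ _ (fun y _ => E y)) (RintegralD (measurable_cube n) ii IHi).
by rewrite (RintegralZl _ (measurable_cube n) (icoord i)) IHr big_cons.
Qed.

(* The witness is the mean of the law with density proportional to
   [expR (dot u y)] on the cube; the inequality is Jensen's. *)
Lemma tilted_mean mu n u : (0 < mgf mu (cube n) u)%E ->
  exists2 z, edom (rate mu) z &
    (mgf mu (cube n) u <= (expR (dot u z - fine (rate mu z)))%:E)%E.
Proof.
move=> m0; have mc := measurable_cube n.
have i1 : mu.-integrable (cube n : set B) (EFin \o (fun y : B => expR (dot u y))).
  have H : mu.-integrable (cube n : set B) (EFin \o (fun y : B => 1 * expR (dot u y))).
    by apply: (@integrable_cube mu n u (cst 1) 1) => [|y _];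
      [exact: measurable_cst|rewrite normr1].
  by apply: eq_integrable H => // y _ /=; rewrite mul1r.
set m := \int[mu]_(y in (cube n : set B)) expR (dot u y).
have mE : mgf mu (cube n) u = m%:E.
  by rewrite /m /Rintegral fineK//; exact: integrable_fin_num.
have {}m0 : 0 < m by move: m0; rewrite mE lte_fin.
pose z : V := \row_i (m^-1 * \int[mu]_(y in (cube n : set B)) ((y : V) ord0 i * expR (dot u y))).
have key w : edom (cgf mu) w -> dot w z - fine (cgf mu w) <= dot u z - ln m.
  move=> Dw; set s := dot (w - u) z.
  suff : expR s * m <= expR (fine (cgf mu w)).
    rewrite -{1}[m]lnK// -expRD ler_expR /s dotBl; lra.
  rewrite -lee_fin -mgfE//; apply: (@le_trans _ _ (mgf mu (cube n) w)); last first.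
    by apply: ge0_subset_integral => //; exact: measurable_expR_dot.
  have iw : mu.-integrable (cube n : set B) (EFin \o (fun y : B => expR (dot w y))).
    by apply: integrableS (integrable_expR_dot Dw).
  have [ih hE] := Rintegral_dot_cube mu n u (w - u) (index_enum 'I_d).
  have i1s := integrableZl mc (1 - s) i1.
  have -> : mgf mu (cube n) w = (\int[mu]_(y in (cube n : set B)) expR (dot w y))%:E.
    by rewrite /Rintegral fineK//; exact: integrable_fin_num.
  rewrite lee_fin.
  have iD := integrableD mc i1s ih.
  have hm : \int[mu]_(y in (cube n : set B))
    ((1 - s) * expR (dot u y) + dot (w - u) y * expR (dot u y)) = m.
    rewrite (RintegralD mc i1s ih) (RintegralZl _ mc i1) -/m hE.
    rewrite (_ : \sum_(i <- _) _ = m * s); first by ring.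
    rewrite /s /dot mulr_sumr; apply: eq_bigr => i _; rewrite [z _ _]mxE.
    by rewrite (mulrCA m) mulVKf ?gt_eqF.
  rewrite -{1}hm -(RintegralZl _ mc iD).
  apply: le_Rintegral => //; first exact: (integrableZl mc (expR s) iD).
  move=> y _; rewrite -mulrDl mulrA.
  (* Jensen's inequality comes from the tangent to the exponential at [s], the mean of
     [dot (w - u) y] under the tilted law. *)
  have -> : dot w y = s + (dot (w - u) y - s) + dot u y by rewrite dotBl; ring.
  rewrite !expRD ler_pM2r ?expR_gt0// ler_pM2l ?expR_gt0//.
  by rewrite -expRD; apply: le_trans (expR_ge1Dx _); rewrite /dot; lra.
have [Ez iz] := (@rate_conjugate _ _ mu z (dot u z - ln m)).2 key.
exists z => //; rewrite mE lee_fin -{1}[m]lnK// ler_expR.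
by move: iz => /=; lra.
Qed.

(** The nontrivial half bounds the integral over each cube by [tilted_mean] and lets the cubes
    exhaust the space by monotone convergence. *)
Lemma cgf_conjugate mu :
  conjugate (edom (rate mu)) (fine \o rate mu) (edom (cgf mu)) (fine \o cgf mu).
Proof.
move=> u c; split=> [[Du uc] v Ev|H].
  have := conjugate_ineq (@rate_conjugate _ _ mu) Du Ev; move: uc => /=; rewrite dotC; lra.
apply: mgf_le; have mgf_cvg : (mgf mu (cube n) u @[n --> \oo] --> mgf mu setT u)%E.
  have <- : \bigcup_n (cube n : set B) = setT.
    apply/seteqP; split=> // y _; exists (Num.truncn `|y : V|).+1 => //=.
    by rewrite /cube/= ltW// truncnS_gt.
  apply: ge0_nondecreasing_set_cvg_integral.
  - move=> n m nm; apply/subsetPset => y; rewrite /cube/= => /le_trans; apply.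
    by rewrite ler_nat.
  - exact: measurable_cube.
  - by move=> n; exact: measurable_expR_dot.
  - by move=> n y _; rewrite lee_fin expR_ge0.
rewrite -(cvg_lim _ mgf_cvg)//; apply: lime_le; first by apply/cvg_ex; exists (mgf mu setT u).
apply: nearW => n; have [->|m0] := eqVneq (mgf mu (cube n) u) 0%E;
  first by rewrite lee_fin expR_ge0.
have [|z Ez /le_trans] := @tilted_mean mu n u; first by rewrite lt_def m0 mgf_ge0.
by apply; rewrite lee_fin ler_expR dotC; exact: H.
Qed.

(** Over an empty domain the conjugate is below every real, but [cgf mu 0] is 0. *)
Lemma edom_rate_nonempty mu : edom (rate mu) !=set0.
Proof.
apply: contrapT => E0; have [D0 k0] := edom_cgf0 mu.
have [|_] := (@cgf_conjugate mu 0 (- 1)).2.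
  by move=> v Ev; case: E0; exists v.
by rewrite /= k0; lra.
Qed.

Lemma rate_convex mu : convex_on (edom (rate mu)) (fine \o rate mu).
Proof. exact: conjugate_convex (@rate_conjugate _ _ mu). Qed.

Lemma cgf_convex mu : convex_on (edom (cgf mu)) (fine \o cgf mu).
Proof. exact: conjugate_convex (@cgf_conjugate mu). Qed.

End Biconjugate.

(** * Conditioning *)

Section Conditioning.
Context {R : realType} {d : nat}.
Local Notation V := 'rV[R]_d.
Local Notation B := (borel_rV R d).
Local Notation law := (probability (borel_rV R d) R).
Implicit Types (mu : law) (A L : set V) (u v w a h x y z : V) (b c s t : R).

Lemma measurable_halfspace a b : measurable ([set x | dot a x <= b] : set B).
Proof. by apply: measurable_closed; exact: closed_dot_le. Qed.

Lemma measurable_hyperplane a b : measurable ([set x | dot a x = b] : set B).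
Proof. by apply: measurable_closed; exact: closed_dot_eq. Qed.

Lemma prob_fin mu A : measurable (A : set B) -> mu A = (fine (mu A))%:E.
Proof. by move=> mA; rewrite fineK// fin_num_measure. Qed.

Lemma cond_lawE mu A (U : set B) : measurable (A : set B) -> (0 < mu A)%E ->
  cond_law mu A U = (mu (U `&` A) * ((fine (mu A))^-1)%:E)%E.
Proof.
move=> mA A0; rewrite /cond_law; case: pselect => // mA'.
have E : mrestr mu mA' setT = mu A by rewrite /mrestr setTI.
have muoo : (mu A == +oo%E) = false.
  by apply/negbTE; rewrite -ltey (le_lt_trans (probability_le1 _ mA))// ltry.
by rewrite /= /mnormalize /= E gt_eqF//= muoo.
Qed.

Lemma cond_law_mgf mu A u : measurable (A : set B) -> (0 < mu A)%E ->
  mgf (cond_law mu A) setT u = (((fine (mu A))^-1)%:E * mgf mu A u)%E.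
Proof.
move=> mA A0; have f0 : 0 <= (fine (mu A))^-1 by rewrite invr_ge0 fine_ge0.
rewrite /mgf (@ge0_negligible_integral _ _ _ (cond_law mu A) setT (~` (A : set B))) //.
- rewrite setTD setCK -(ge0_integral_mscale mu mA (NngNum f0) (@measurable_expR_dot _ _ A u)).
    apply: eq_measure_integral => U mU UA; rewrite /mscale/= cond_lawE// muleC.
    by rewrite (setIidl UA).
  by move=> y _; rewrite lee_fin expR_ge0.
- exact: measurableC.
- exact: measurable_expR_dot.
- by have := @cond_lawE mu A (~` (A : set B)) mA A0; rewrite setICl measure0 mul0e.
Qed.

Lemma cond_law_cgf mu A u : measurable (A : set B) -> (0 < mu A)%E ->
  edom (cgf (cond_law mu A)) u ->
  mgf mu A u = (expR (fine (cgf (cond_law mu A) u) + ln (fine (mu A))))%:E.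
Proof.
move=> mA A0 Du; have := mgfE Du; rewrite cond_law_mgf//.
have f0 : 0 < fine (mu A) by rewrite -lte_fin -prob_fin.
by move=> H; rewrite expRD lnK// mulrC EFinM -H muleA -EFinM divff ?gt_eqF// mul1e.
Qed.

Lemma cond_law_edom mu A u : measurable (A : set B) -> (0 < mu A)%E ->
  edom (cgf (cond_law mu A)) u <-> (mgf mu A u < +oo)%E.
Proof.
move=> mA A0; rewrite edom_cgf cond_law_mgf//.
have f0 : 0 < fine (mu A) by rewrite -lte_fin -prob_fin.
have := mgf_ge0 mu A u; case: (mgf mu A u) => [r|//|//] _.
  by rewrite -EFinM !ltry.
by rewrite gt0_muley// lte_fin invr_gt0.
Qed.

Lemma mgf_le_setT mu A u : measurable (A : set B) -> (mgf mu A u <= mgf mu setT u)%E.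
Proof.
move=> mA; apply: ge0_subset_integral => //; exact: measurable_expR_dot.
Qed.

Lemma edom_cond_law mu A : measurable (A : set B) -> (0 < mu A)%E ->
  edom (cgf mu) `<=` edom (cgf (cond_law mu A)).
Proof.
move=> mA A0 u /edom_cgf ulty; apply/cond_law_edom => //.
exact: le_lt_trans (mgf_le_setT _ _ mA) ulty.
Qed.

Lemma cgf_ge_cond_law mu A u : measurable (A : set B) -> (0 < mu A)%E ->
  edom (cgf mu) u -> fine (cgf (cond_law mu A) u) + ln (fine (mu A)) <= fine (cgf mu u).
Proof.
move=> mA A0 Du; rewrite -ler_expR -lee_fin -(mgfE Du).
by rewrite -(cond_law_cgf mA A0 (edom_cond_law mA A0 Du)); exact: mgf_le_setT.
Qed.

Lemma cond_law_shift mu A a b u t : measurable (A : set B) -> (0 < mu A)%E ->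
  A `<=` [set x | dot a x = b] -> edom (cgf (cond_law mu A)) u ->
  edom (cgf (cond_law mu A)) (u + t *: a) /\
  fine (cgf (cond_law mu A) (u + t *: a)) = fine (cgf (cond_law mu A) u) + t * b.
Proof.
move=> mA A0 AL Du.
have E : mgf mu A (u + t *: a) = ((expR (t * b))%:E * mgf mu A u)%E.
  rewrite /mgf -ge0_integralZl//.
  - apply: eq_integral => y; rewrite inE => /AL /= ay.
    by rewrite -EFinM dotDl dotZl ay expRD mulrC.
  - exact: measurable_expR_dot.
have Dt : edom (cgf (cond_law mu A)) (u + t *: a).
  by apply/cond_law_edom => //; rewrite E (cond_law_cgf mA A0 Du) -EFinM ltry.
split=> //; have := cond_law_cgf mA A0 Dt.
rewrite E (cond_law_cgf mA A0 Du) -EFinM -expRD => -[/expR_inj]; lra.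
Qed.

Lemma mgf_null mu A u : measurable (A : set B) -> mu A = 0%E -> mgf mu A u = 0%E.
Proof. by move=> mA A0; apply: null_set_integral => //; exact: measurable_expR_dot. Qed.

Lemma mgf_ae mu A C u : measurable (A : set B) -> measurable (C : set B) -> C `<=` A ->
  mu C = mu A -> mgf mu A u = mgf mu C u.
Proof.
move=> mA mC CA E; rewrite /mgf (@ge0_negligible_integral _ _ _ mu A ((A : set B) `\` C)) //.
- by rewrite setDD (setIidr CA).
- exact: measurableD.
- exact: measurable_expR_dot.
- have Clty : (mu C < +oo)%E by rewrite (le_lt_trans (probability_le1 _ mC))// ltry.
  have Alty : (mu A < +oo)%E by rewrite -E.
  transitivity (mu A - mu C)%E; last by rewrite E subee// (prob_fin mu mA).
  by rewrite -{2}(setIidr CA); exact: measureD.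
Qed.

Lemma mgf_full mu A u : measurable (A : set B) -> mu A = 1%E -> mgf mu setT u = mgf mu A u.
Proof.
move=> mA A1; apply: mgf_ae => //; rewrite A1; apply/esym; exact: probability_setT.
Qed.

Lemma halfspace_mgf mu a b u t : mu [set x | dot a x <= b] = 1%E -> 0 <= t ->
  edom (cgf mu) u -> edom (cgf mu) (u + t *: a) /\
  fine (cgf mu (u + t *: a)) <= fine (cgf mu u) + t * b.
Proof.
move=> H1 t0 Du; have mH := measurable_halfspace a b.
apply: mgf_le; rewrite expRD mulrC EFinM -(mgfE Du).
rewrite (mgf_full _ mH H1) (mgf_full u mH H1) /mgf -ge0_integralZl//.
- apply: ge0_le_integral => //.
  + exact: measurable_expR_dot.
  + rewrite (_ : (fun y => _) = (fun y => (expR (t * b) * expR (dot u y))%:E))//.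
    apply/measurable_EFinP; apply: measurable_funM; first exact: measurable_cst.
    exact: measurable_expR_dotr.
  + move=> y /= ay; rewrite -EFinM lee_fin -expRD ler_expR dotDl dotZl addrC lerD2r.
    by rewrite ler_wpM2l.
- exact: measurable_expR_dot.
Qed.

(** Both sides amount to [cgf mu (t *: a) <= t * b] for all [t >= 0]. Letting [t] grow makes the
    rate infinite beyond the half-space in one direction, and is Chernoff's bound in the other. *)
Lemma halfspace_edom_rate mu a b :
  edom (rate mu) `<=` [set x | dot a x <= b] <-> mu [set x | dot a x <= b] = 1%E.
Proof.
have [D0 k0] := edom_cgf0 mu; split; last first.
  move=> H1 v Ev; rewrite /= leNgt; apply/negP => bv.
  have key t : 0 <= t -> t * (dot a v - b) <= fine (rate mu v).
    move=> t0; have [Dt kt] := halfspace_mgf H1 t0 D0.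
    have := conjugate_ineq (@rate_conjugate _ _ mu) Dt Ev; move: kt.
    by rewrite add0r k0 add0r dotZl /=; lra.
  (* At this [t] the left side of [key] equals the rate plus 1. *)
  have t0 : 0 <= (fine (rate mu v) + 1) / (dot a v - b).
    by rewrite divr_ge0 ?subr_ge0 ?(ltW bv)// addr_ge0// rate_ge0.
  by have := key _ t0; rewrite divfK ?gt_eqF ?subr_gt0//; lra.
move=> EH.
have key t : 0 <= t -> (mgf mu setT (t *: a) <= (expR (t * b))%:E)%E.
  move=> t0; have [|Dt kt] := (@cgf_conjugate _ _ mu (t *: a) (t * b)).2.
    move=> v Ev; have := EH _ Ev; have := rate_ge0 Ev; rewrite /= dotZr dotC => i0 av.
    by have := ler_wpM2l t0 av; lra.
  by rewrite mgfE// lee_fin ler_expR.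
pose An n : set B := [set x | b + n.+1%:R^-1 <= dot a x].
have mAn n : measurable (An n).
  rewrite (_ : An n = [set x | dot (- a) x <= - (b + n.+1%:R^-1)]);
    first exact: measurable_halfspace.
  by apply/seteqP; split=> x /=; rewrite dotNl lerN2.
have An0 n : mu (An n) = 0%E.
  rewrite (prob_fin mu (mAn n)); congr EFin; apply/eqP; rewrite eq_le fine_ge0// andbT.
  set p := fine _; set e := n.+1%:R^-1 : R; have e0 : 0 < e by rewrite invr_gt0.
  have p0 : 0 <= p by exact: fine_ge0.
  have pt t : 0 <= t -> p * (1 + t * e) <= 1.
    move=> t0; have : p * expR (t * (b + e)) <= expR (t * b).
      rewrite -lee_fin; apply: le_trans (key _ t0); apply: le_trans (mgf_le_setT _ _ (mAn n)).
      rewrite mulrC EFinM -(prob_fin mu (mAn n)) -integral_cst//; apply: ge0_le_integral => //.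
      + by move=> y _; rewrite lee_fin expR_ge0.
      + exact: measurable_expR_dot.
      + by move=> y; rewrite /An/= => ay; rewrite lee_fin ler_expR dotZl ler_wpM2l.
    rewrite mulrDr addrC expRD mulrA -{2}[expR (t * b)]mul1r ler_pM2r ?expR_gt0//.
    by apply: le_trans; rewrite ler_wpM2l// expR_ge1Dx.
  rewrite leNgt; apply/negP => p_gt0.
  (* This [t] turns the bound into [p + 1 <= 1]. *)
  have := pt ((p^-1) / e); rewrite divfK ?gt_eqF// mulrDr mulr1 mulfV ?gt_eqF//.
  by rewrite divr_ge0 ?invr_ge0 ?(ltW e0)// => /(_ isT); lra.
have HE : ~` ([set x | dot a x <= b] : set B) = \bigcup_n An n.
  apply/seteqP; split=> x /=.
    move/negP; rewrite -ltNge => bx.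
    exists (Num.truncn (dot a x - b)^-1) => //; rewrite /An/= -lerBrDl.
    rewrite invf_ple ?posrE ?subr_gt0 ?ltr0n// ltW//; exact: truncnS_gt.
  case=> n _; rewrite /An/= => H; apply/negP; rewrite -ltNge (lt_le_trans _ H)//.
  by rewrite ltrDl invr_gt0.
have mH := measurable_halfspace a b.
have H0 : mu (~` ([set x | dot a x <= b] : set B)) = 0%E.
  rewrite HE; apply/(negligibleP mu); first exact: bigcupT_measurable.
  by apply: negligible_bigcup => n; apply/(negligibleP mu (mAn n)); exact: An0.
have := probability_setC mu mH.
by rewrite H0 (prob_fin mu mH) -EFinB => -[] /eqP; rewrite eq_sym subr_eq0 => /eqP <-.
Qed.

End Conditioning.

(** * The rate function on a supporting hyperplane *)

Section Faces.
Context {R : realType} {d : nat}.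
Local Notation V := 'rV[R]_d.
Local Notation B := (borel_rV R d).
Local Notation law := (probability (borel_rV R d) R).
Implicit Types (mu : law) (A L : set V) (u v w a h x y z : V) (b c s t : R).

(** An exponential tilt along [a] concentrates on the bounding hyperplane: dominated convergence,
    with [expR (dot u y)] as dominating function on the half-space. *)
Lemma mgf_face_cvg mu a b u : mu [set x | dot a x <= b] = 1%E -> edom (cgf mu) u ->
  ((expR (- (n%:R * b)))%:E * mgf mu setT (u + n%:R *: a) @[n --> \oo] -->
   mgf mu [set x | dot a x = b] u)%E.
Proof.
move=> H1 Du; have mH := measurable_halfspace a b; have mL := measurable_hyperplane a b.
set H := [set x | dot a x <= b]; set L := [set x | dot a x = b].
pose f_ (n : nat) (y : B) := (expR (dot u y + n%:R * (dot a y - b)))%:E.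
have fE n : ((expR (- (n%:R * b)))%:E * mgf mu setT (u + n%:R *: a) = \int[mu]_(y in (H : set B)) f_ n y)%E.
  rewrite (mgf_full _ mH H1) /mgf -ge0_integralZl//; last exact: measurable_expR_dot.
  apply: eq_integral => y _; rewrite -EFinM -expRD /f_ dotDl dotZl; congr (expR _)%:E; ring.
under eq_fun do rewrite fE.
pose f := (fun y : B => (expR (dot u y))%:E) \_ (L : set B).
have -> : mgf mu L u = (\int[mu]_(y in (H : set B)) f y)%E.
  rewrite -integral_mkcondr (setIidr _)//; move=> y; rewrite /L /H /= => ->.
  exact: lexx.
have mf : measurable_fun (H : set B) f.
  apply: measurable_funTS; apply/(measurable_restrictT _ mL); exact: measurable_expR_dot.
have mf_ n : measurable_fun (H : set B) (f_ n).
  rewrite (_ : f_ n = (fun y => (expR (- (n%:R * b)) * expR (dot (u + n%:R *: a) y))%:E)).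
    apply/measurable_EFinP; apply: measurable_funM; first exact: measurable_cst.
    exact: measurable_expR_dotr.
  apply/funext => y; rewrite -expRD /f_ dotDl dotZl; congr (expR _)%:E; ring.
have intH := integrableS measurableT mH (@subsetT _ _) (integrable_expR_dot Du).
have [||_ _ //] := dominated_convergence mH mf_ mf _ intH.
- apply: aeW => y; rewrite /H /= le_eqVlt => /orP[/eqP ay|ay].
    rewrite /f patchE mem_set// (_ : (f_ ^~ y) = (fun=> (expR (dot u y))%:E)); first exact: cvg_cst.
    by apply/funext => n; rewrite /f_ ay subrr mulr0 addr0.
  rewrite /f patchE memNset; last by rewrite /L/= => /eqP; rewrite lt_eqF.
  apply: cvg_EFin; first exact: nearW.
  (* Off the hyperplane the integrands form a geometric sequence of ratio below 1. *)
  rewrite [X in X @ _ --> _](_ : _ = geometric (expR (dot u y)) (expR (dot a y - b))).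
    by apply: cvg_geometric; rewrite ger0_norm ?expR_ge0// expR_lt1 subr_lt0.
  by apply/funext => n; rewrite /= expRD expRM_natl.
- apply: aeW => y n; rewrite /H/= => ay.
  by rewrite ger0_norm ?expR_ge0// lee_fin ler_expR gerDl mulr_ge0_le0// subr_le0.
Qed.

(** Fenchel's inequality at [u + n a] and [v]: since [dot a v = b], the terms in [n] cancel, and
    [mgf_face_cvg] gives the limit. *)
Lemma rate_face_ge mu a b v u c : mu [set x | dot a x <= b] = 1%E -> dot a v = b ->
  edom (rate mu) v -> fine (rate mu v) <= c -> edom (cgf mu) u ->
  ((expR (dot u v - c))%:E <= mgf mu [set x | dot a x = b] u)%E.
Proof.
move=> H1 av Ev ic Du; have lim := mgf_face_cvg H1 Du.
rewrite -(cvg_lim _ lim)//; apply: lime_ge; first by apply/cvg_ex; eexists; exact: lim.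
apply: nearW => n; have [Dn _] := halfspace_mgf H1 (ler0n R n) Du.
rewrite (mgfE Dn) -EFinM -expRD lee_fin ler_expR.
have := conjugate_ineq (@rate_conjugate _ _ mu) Dn Ev.
by move: ic; rewrite dotDl dotZl av /=; lra.
Qed.

Lemma rate_null_face mu a b v : mu [set x | dot a x <= b] = 1%E ->
  mu [set x | dot a x = b] = 0%E -> dot a v = b -> ~ edom (rate mu) v.
Proof.
move=> H1 L0 av Ev; have [D0 _] := edom_cgf0 mu.
have := rate_face_ge H1 av Ev (lexx _) D0.
by rewrite (mgf_null _ (measurable_hyperplane _ _) L0) lee_fin leNgt expR_gt0.
Qed.

(** The supremum runs over the domain of [cgf mu], not over the larger one of the conditioned law;
    removing this gap is the task of the projection condition. [A] may be the hyperplane itself or a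
    face of [csupp mu] filling it up to a null set. *)
Lemma rate_face mu a b A : mu [set x | dot a x <= b] = 1%E ->
  measurable (A : set B) -> A `<=` [set x | dot a x = b] ->
  mu A = mu [set x | dot a x = b] -> (0 < mu A)%E ->
  forall v, dot a v = b -> forall c,
  (edom (rate mu) v /\ (fine \o rate mu) v <= c) <->
  (forall u, edom (cgf mu) u -> dot u v - (fine \o cgf (cond_law mu A)) u <= c + ln (fine (mu A))).
Proof.
move=> H1 mA AL E A0 v av c; have mL := measurable_hyperplane a b.
split=> [[Ev ic] u Du|H].
  have := rate_face_ge H1 av Ev ic Du; rewrite (mgf_ae u mL mA AL E).
  rewrite (cond_law_cgf mA A0 (edom_cond_law mA A0 Du)) lee_fin ler_expR /=; lra.
apply/rate_conjugate => u Du; have := H _ Du; have := cgf_ge_cond_law mA A0 Du.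
by rewrite /=; lra.
Qed.

End Faces.

(** * Differentiability of the cumulant generating function *)

(** The excess [r] of [k] over its tangent is controlled by the second difference [q] of [expR k].
    The last hypothesis says [4 q(t/2) <= q(t)], so [q] decays quadratically along [tau / 2^n], and
    convexity of [r] fills in the points between. *)
Lemma second_difference_derivative {R : realType} (k : R -> R) (tau g : R) : 0 < tau ->
  (forall t, - tau <= t <= tau -> k 0 + t * g <= k t) ->
  (forall s c, 0 <= s <= 1 -> - tau <= c <= tau -> k (s * c) <= (1 - s) * k 0 + s * k c) ->
  (forall t, 0 <= t <= tau -> 4 * (expR (k (t / 2)) + expR (k (- (t / 2)))) <=
     expR (k t) + expR (k (- t)) + 6 * expR (k 0)) ->
  t^-1 * (k t - k 0) @[t --> 0^'] --> g.
Proof.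
move=> tau0 sg conv half.
have [r rE] : exists r : R -> R, forall t, r t = k t - k 0 - t * g by eexists.
have r0 t : - tau <= t <= tau -> 0 <= r t by move=> /sg; rewrite rE; lra.
have [f0 f0E] : exists f0, f0 = expR (k 0) by eexists.
have fu : 0 < f0 by rewrite f0E expR_gt0.
have [q qE] : exists q : R -> R, forall t, q t = expR (k t) + expR (k (- t)) - 2 * f0 by eexists.
have f_r t : f0 * (1 + t * g + r t) <= expR (k t).
  rewrite (_ : k t = k 0 + (t * g + r t)); last by rewrite rE; ring.
  by rewrite expRD f0E ler_pM2l ?expR_gt0// -addrA expR_ge1Dx.
have q_r t : - tau <= t <= tau -> f0 * r t <= q t.
  move=> tt; have tt' : - tau <= - t <= tau by lra.
  have := f_r t; have := f_r (- t); have := mulr_ge0 (ltW fu) (r0 _ tt').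
  rewrite qE; lra.
have q_half t : 0 <= t <= tau -> 4 * q (t / 2) <= q t.
  by move=> /half; rewrite !qE -f0E; lra.
have p0 n : 0 < 2 ^+ n :> R by rewrite exprn_gt0.
have p1 n : 1 <= 2 ^+ n :> R by rewrite exprn_ege1// ler1n.
have Tle n : tau / 2 ^+ n <= tau by rewrite ler_pdivrMr// ler_peMr// ltW.
have T0 n : 0 < tau / 2 ^+ n by rewrite divr_gt0.
have q_pow n : 4 ^+ n * q (tau / 2 ^+ n) <= q tau.
  elim: n => [|n IH]; first by rewrite !expr0 divr1 mul1r.
  apply: le_trans IH; rewrite exprSr -mulrA ler_pM2l ?exprn_gt0//.
  by rewrite exprSr invfM mulrA; apply: q_half; rewrite ltW//=.
(* [t] is the fraction [|t| / T] of an endpoint [c], equal to [T] or [- T]; by convexity [r t] is at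
   most this fraction of [r c], and [q] is even. *)
have key n t : - (tau / 2 ^+ n) <= t <= tau / 2 ^+ n ->
    f0 * r t <= `|t| * (q tau / tau / 2 ^+ n).
  have [T TE] : exists T, T = tau / 2 ^+ n by eexists.
  rewrite -TE => tT; have T_gt0 : 0 < T by rewrite TE.
  have Ttau : T <= tau by rewrite TE.
  have rconv s c : 0 <= s <= 1 -> - tau <= c <= tau -> r (s * c) <= s * r c.
    by move=> s01 /(conv _ _ s01); rewrite !rE; lra.
  have s01 : 0 <= `|t| / T <= 1.
    by rewrite (divr_ge0 (normr_ge0 t) (ltW T_gt0))/= ler_pdivrMr// mul1r ler_norml.
  have [c [cT rc cE]] : exists c, [/\ - tau <= c <= tau, q c = q T & t = `|t| / T * c].
    have [t0|t0] := leP 0 t.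
      by exists T; split=> //; [lra|rewrite ger0_norm// divfK// gt_eqF].
    exists (- T); split; first by lra.
      by rewrite !qE opprK; ring.
    by rewrite ltr0_norm// mulrN divfK ?gt_eqF// opprK.
  rewrite {1}cE; apply: (@le_trans _ _ (`|t| / T * q T)).
    rewrite -rc; apply: le_trans (ler_wpM2l (ltW fu) (rconv _ _ s01 cT)) _.
    by rewrite mulrCA; apply: ler_wpM2l; [case/andP: s01|exact: q_r].
  rewrite -mulrA; apply: ler_wpM2l => //.
  rewrite -(ler_pM2l T_gt0) mulrA mulfV ?gt_eqF// mul1r.
  rewrite (_ : T * _ = q tau / (2 ^+ n * 2 ^+ n)); last first.
    by rewrite TE; field; rewrite !gt_eqF.
  rewrite ler_pdivlMr ?mulr_gt0// -exprMn mulrC TE.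
  by have := q_pow n; rewrite (_ : 2 * 2 = 4 :> R)//; ring.
apply/cvgrPdist_le => ep ep0.
have [n nep] : exists n, q tau / tau / f0 / 2 ^+ n <= ep.
  have [C CE] : exists C, C = q tau / tau / f0 by eexists.
  rewrite -CE; exists (Num.truncn (C / ep)).+1.
  rewrite ler_pdivrMr// -ler_pdivrMl// mulrC.
  apply: le_trans (ltW (truncnS_gt _)) _.
  by rewrite -natrX ler_nat ltnW// ltn_expl.
near=> t.
have t0 : t != 0 by near: t; exact: nbhs_dnbhs_neq.
have tT : - (tau / 2 ^+ n) <= t <= tau / 2 ^+ n.
  by rewrite -ler_norml; near: t; exact: dnbhs0_le.
have tt : - tau <= t <= tau by have := Tle n; lra.
have -> : g - t^-1 * (k t - k 0) = - (r t / t) by rewrite rE; field.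
have nt0 : 0 < `|t| by rewrite normr_gt0.
rewrite normrN normrM normfV (ger0_norm (r0 _ tt)) ler_pdivrMr//.
rewrite -(ler_pM2l fu); apply: le_trans (key n t tT) _.
rewrite (_ : f0 * (ep * `|t|) = `|t| * (ep * f0)); last by ring.
by apply: ler_wpM2l; [exact: ltW|rewrite -ler_pdivrMr// mulrAC].
Unshelve. all: by end_near.
Qed.

Section Differentiability.
Context {R : realType} {d : nat}.
Local Notation V := 'rV[R]_d.
Local Notation B := (borel_rV R d).
Local Notation law := (probability (borel_rV R d) R).
Implicit Types (mu : law) (A L : set V) (u v w a g h x y z : V) (b c s t : R).

(* With [c = e^s + e^(-s)], the pointwise inequality is [(c - 2)^2 >= 0]. *)
Lemma cgf_second_difference mu u h :
  edom (cgf mu) u ->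
  edom (cgf mu) (u + h) -> edom (cgf mu) (u - h) ->
  edom (cgf mu) (u + 2 *: h) -> edom (cgf mu) (u - 2 *: h) ->
  4 * (expR (fine (cgf mu (u + h))) + expR (fine (cgf mu (u - h)))) <=
  expR (fine (cgf mu (u + 2 *: h))) + expR (fine (cgf mu (u - 2 *: h))) +
  6 * expR (fine (cgf mu u)).
Proof.
move=> D0 D1 D2 D3 D4; have mT := @measurableT _ B.
have fE w : edom (cgf mu) w -> expR (fine (cgf mu w)) = \int[mu]_(y in [set: B]) expR (dot w y).
  move=> Dw; have := mgfE Dw; rewrite /mgf /Rintegral => ->.
  by [].
have I0 := integrable_expR_dot D0; have I1 := integrable_expR_dot D1.
have I2 := integrable_expR_dot D2; have I3 := integrable_expR_dot D3.
have I4 := integrable_expR_dot D4.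
have I12 := integrableD mT I1 I2; have I34 := integrableD mT I3 I4.
have I6 := integrableZl mT 6 I0; have I346 := integrableD mT I34 I6.
have E12 := RintegralD mT I1 I2; have E34 := RintegralD mT I3 I4.
rewrite (fE _ D0) (fE _ D1) (fE _ D2) (fE _ D3) (fE _ D4).
rewrite -[X in _ * X <= _]E12 -[X in _ <= X + _]E34.
rewrite -(RintegralZl 4 mT I12)  -(RintegralZl 6 mT I0) -(RintegralD mT I34 I6).
apply: (le_Rintegral mT (integrableZl mT 4 I12) I346) => y _.
have dot2 : dot (2 *: h) y = dot h y + dot h y by rewrite dotZl; ring.
rewrite !dotDl !dotNl !expRD !expRN dot2 expRD.
set p := expR (dot u y); set q := expR (dot h y).
have p0 : 0 < p by exact: expR_gt0.
have q0 : 0 < q by exact: expR_gt0.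
rewrite -subr_ge0 (_ : _ - _ = p * (q + q^-1 - 2) ^+ 2).
  by rewrite mulr_ge0 ?sqr_ge0// ltW.
by field; rewrite gt_eqF.
Qed.

(** Obtains the derivative from any subgradient, without differentiating under the integral; in
    particular the subgradient at an interior point is unique. *)
Lemma derive_cgf mu u g (i : 'I_d) : (edom (cgf mu))° u ->
  subgradient (edom (cgf mu)) (fine \o cgf mu) u g ->
  'D_(delta_mx ord0 i) (fine \o cgf mu) u = g ord0 i.
Proof.
move=> Du sg; have [tau tau0 Dt] := interior_line (delta_mx ord0 i) Du.
have Du0 := interior_subset Du.
pose k t := fine (cgf mu (t *: delta_mx ord0 i + u)).
have k0 : k 0 = fine (cgf mu u) by rewrite /k scale0r add0r.
have {}Dt t : - tau <= t <= tau -> edom (cgf mu) (t *: delta_mx ord0 i + u).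
  by rewrite addrC; exact: Dt.
apply: cvg_lim => //.
suff : t^-1 * (k t - k 0) @[t --> 0^'] --> g ord0 i by rewrite k0.
apply: (second_difference_derivative tau0).
- move=> t /Dt Dut; have := sg _ Dut; rewrite /= addrK dotZr dot_delta k0 => ->.
  by [].
- move=> s c s01 /Dt Dc; have [_] := (@cgf_convex _ _ mu) u _ s s01 Du0 Dc.
  rewrite k0 /k /= (_ : lpoint _ _ _ = (s * c) *: delta_mx ord0 i + u)//.
  by apply/rowP => j; rewrite !mxE; ring.
- move=> t /andP[t0 t1].
  have := @cgf_second_difference mu u ((t / 2) *: delta_mx ord0 i) Du0.
  have -> : u - 2 *: ((t / 2) *: delta_mx ord0 i) = (- t) *: delta_mx ord0 i + u.
    by apply/rowP => j; rewrite !mxE; field.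
  have -> : u + 2 *: ((t / 2) *: delta_mx ord0 i) = t *: delta_mx ord0 i + u.
    by apply/rowP => j; rewrite !mxE; field.
  rewrite -scaleNr !(addrC u) k0; apply; apply: Dt; lra.
Qed.

Lemma grad_cgf mu u g : (edom (cgf mu))° u ->
  subgradient (edom (cgf mu)) (fine \o cgf mu) u g -> grad (fine \o cgf mu) u = g.
Proof. by move=> Du sg; apply/rowP => i; rewrite mxE; exact: derive_cgf. Qed.

End Differentiability.

(** * Support *)

Section Support.
Context {R : realType} {d : nat}.
Local Notation V := 'rV[R]_d.
Local Notation B := (borel_rV R d).
Local Notation law := (probability (borel_rV R d) R).
Implicit Types (mu : law) (A C L : set V) (u v w a g h x y z : V) (b c s t : R).

Lemma prob_setC0 mu A : measurable (A : set B) -> mu (~` (A : set B)) = 0%E <-> mu A = 1%E.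
Proof.
move=> mA; have := probability_setC mu mA; rewrite (prob_fin mu mA) -EFinB => ->.
by split=> -[] => [/eqP|->]; rewrite ?subrr// subr_eq0 => /eqP <-.
Qed.

Lemma prob1S mu A C : measurable (A : set B) -> measurable (C : set B) -> A `<=` C ->
  mu A = 1%E -> mu C = 1%E.
Proof.
move=> mA mC AC A1; apply/eqP; rewrite eq_le probability_le1//= -A1.
by apply: le_measure; rewrite ?inE.
Qed.

Lemma prob1I mu A C : measurable (A : set B) -> measurable (C : set B) ->
  mu C = 1%E -> mu (A `&` C) = mu A.
Proof.
move=> mA mC C1; have mAC : measurable ((A : set B) `&` C) by exact: measurableI.
apply/eqP; rewrite eq_le; apply/andP; split.
  by apply: le_measure; rewrite ?inE//; exact: subIsetl.
have C0 : mu (~` (C : set B)) = 0%E by apply/(prob_setC0 mu mC).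
have -> : mu (A `&` C) = (mu ((A : set B) `&` C) + mu (~` (C : set B)))%E by rewrite C0 adde0.
apply: le_trans (measureU2 _ mAC (measurableC mC)).
apply: le_measure; rewrite ?inE//; first by apply: measurableU => //; exact: measurableC.
by move=> x Ax; have [Cx|Cx] := pselect (C x); [left|right].
Qed.

Lemma supp_closed mu : closed (supp mu).
Proof. by apply: closed_bigI => S []. Qed.

Lemma rational_approx x e : 0 < e ->
  exists q : 'rV[rat]_d, `|x - map_mx (ratr : rat -> R) q| < e.
Proof.
move=> e0; have /choice[q qP] : forall i : 'I_d, exists q : rat,
    x ord0 i - e / 2 < ratr q < x ord0 i + e / 2.
  move=> i; have [|q] := @rat_in_itvoo R (x ord0 i - e / 2) (x ord0 i + e / 2); first by lra.
  by rewrite in_itv/=; exists q.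
exists (\row_i q i); apply: (@le_lt_trans _ _ (e / 2)); last by lra.
apply: norm_rowP => [|i]; first by lra.
by rewrite !mxE ler_norml; have := qP i; lra.
Qed.

Lemma measure_supp mu : mu (supp mu) = 1%E.
Proof.
have ms : measurable (supp mu : set B) by apply: measurable_closed; exact: supp_closed.
apply/(prob_setC0 mu ms); apply/(negligibleP mu (measurableC ms)).
(* An enumeration of the balls with rational centre and radius [1 / (n + 1)], keeping those of
   probability zero; they cover the complement of the support. *)
pose N (j : nat) : set B := if unpickle j is Some qn then
  let U := ball (map_mx (ratr : rat -> R) (qn.1 : 'rV[rat]_d) : V) (qn.2 : nat).+1%:R^-1 in
  if `[< mu U = 0%E >] then U else set0 else set0.
have N0 j : mu.-negligible (N j).
  rewrite /N; case: unpickle => [[q n]|]; last exact: negligible_set0.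
  case: asboolP => U0; last exact: negligible_set0.
  by apply/negligibleP => //; apply: measurable_open; exact: ball_open.
apply: negligibleS (negligible_bigcup N0) => x /= xs.
have [S [[cS S1] Sx]] : exists S, (closed S /\ mu S = 1%E) /\ ~ S x.
  by apply: contrapT => H; apply: xs => S SP; apply: contrapT => Sx; apply: H; exists S.
have /nbhs_ballP[e /= e0 eS] : nbhs x (~` S) by apply: open_nbhs_nbhs; split=> //;
  exact: closed_openC.
have e20 : 0 < e / 2 by rewrite divr_gt0.
set n := Num.truncn (e / 2)^-1; have ne : n.+1%:R^-1 < e / 2.
  by rewrite invf_plt ?posrE ?ltr0n// truncnS_gt.
have n0 : 0 < n.+1%:R^-1 :> R by rewrite invr_gt0 ltr0n.
have [q xq] := rational_approx x n0.
set U := ball (map_mx (ratr : rat -> R) q : V) n.+1%:R^-1.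
have US : U `<=` ~` S.
  move=> y; rewrite /U -ball_normE /= => qy; apply: eS; rewrite -ball_normE /=.
  rewrite (_ : x - y = (x - map_mx ratr q) + (map_mx ratr q - y)); last by rewrite addrA subrK.
  apply: le_lt_trans (ler_normD _ _) _; apply: lt_trans (ltrD xq qy) _.
  by rewrite [ltRHS]splitr ltrD.
have mS := measurable_closed cS.
exists (pickle (q, n)) => //; rewrite /N pickleK /= -/U asboolT.
  by rewrite /U -ball_normE /= -opprB normrN.
have mU : measurable (U : set B) by apply: measurable_open; exact: ball_open.
apply/eqP; rewrite eq_le measure_ge0 andbT.
have /(prob_setC0 mu mS) <- := S1.
by apply: le_measure; rewrite ?inE//; exact: measurableC.
Qed.

Lemma csupp_convex mu : @convex_set R V (csupp mu).
Proof.
apply/convexP => x y t t01 Cx Cy A [vA SA].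
by move/convexP: (vA); apply=> //; [apply: Cx|apply: Cy].
Qed.

Lemma supp_csupp mu : supp mu `<=` csupp mu.
Proof. by move=> x Sx A [_]; apply. Qed.

(** Each stage of a compact set is compact, so the stages present [csupp mu] as a countable union of
    compact sets, hence as a Borel set. *)
Fixpoint hull_stage A (j : nat) : set V :=
  if j is j'.+1 then
    [set lpoint p.1.1 p.1.2 p.2 | p in (hull_stage A j' `*` hull_stage A j') `*` `[0, 1]]
  else A.

Lemma hull_stage_compact A j : compact A -> compact (hull_stage A j).
Proof.
move=> cA; elim: j => //= j IH; apply: continuous_compact; last first.
  by apply: compact_setX; [exact: compact_setX|exact: segment_compact].
apply: continuous_subspaceT => p.
apply: (@lpoint_continuous _ _ _ (fun p : V * V * R => p.1.1) (fun p => p.1.2) snd).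
- exact: (continuous_comp cvg_fst cvg_fst).
- exact: (continuous_comp cvg_fst cvg_snd).
- exact: cvg_snd.
Qed.

Lemma hull_stageS A j : hull_stage A j `<=` hull_stage A j.+1.
Proof.
move=> x Ax; exists ((x, x), 0) => /=; last by rewrite lpoint0.
by split=> //; rewrite in_itv/= lexx ler01.
Qed.

Lemma hull_stage_le A j j' : (j <= j')%N -> hull_stage A j `<=` hull_stage A j'.
Proof.
move=> /subnK <-; elim: (j' - j)%N => // n IH; apply: subset_trans IH _.
by rewrite addSn; exact: hull_stageS.
Qed.

Lemma hull_stage_mono A C j : A `<=` C -> hull_stage A j `<=` hull_stage C j.
Proof.
move=> AC; elim: j => //= j IH _ [[[x y] t] /= [[Ax Ay] t01] <-].
by exists ((x, y), t) => //=; split=> //; split; exact: IH.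
Qed.

Lemma csuppE mu : csupp mu = \bigcup_m \bigcup_j hull_stage (supp mu `&` cube m) j.
Proof.
apply/seteqP; split.
  apply: smallest_sub; last first.
    move=> x Sx; exists (Num.truncn `|x|).+1 => //; exists 0%N => //=; split=> //.
    by rewrite /cube/= ltW// truncnS_gt.
  apply/convexP => x y t t01 [m _ [j _ Kx]] [m' _ [j' _ Ky]].
  exists (maxn m m') => //; exists (maxn j j').+1 => //=.
  exists ((x, y), t) => //=; split; last by rewrite in_itv.
  have cubeS n n' : (n <= n')%N -> supp mu `&` cube n `<=` supp mu `&` cube n'.
    by move=> nn z [Sz cz]; split=> //; apply: le_trans cz _; rewrite ler_nat.
  split.
    apply: hull_stage_mono (cubeS _ _ (leq_maxl m m')) _ _.
    exact: hull_stage_le (leq_maxl j j') _ Kx.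
  apply: hull_stage_mono (cubeS _ _ (leq_maxr m m')) _ _.
  exact: hull_stage_le (leq_maxr j j') _ Ky.
move=> x [m _ [j _]]; elim: j x => [|j IH] x /=; first by move=> [Sx _]; exact: supp_csupp.
move=> [[[y z] t] /= [[Ky Kz] t01] <-].
by move/convexP: (@csupp_convex mu); apply; [rewrite in_itv in t01|exact: IH|exact: IH].
Qed.

Lemma measurable_csupp mu : measurable (csupp mu : set B).
Proof.
rewrite csuppE; apply: bigcupT_measurable => m; apply: bigcupT_measurable => j.
apply: measurable_closed; apply: compact_closed; first exact: norm_hausdorff.
apply: hull_stage_compact; apply: bounded_closed_compact.
  exists m%:R; split=> [|t mt x [_ /= xm]]; first exact: num_real.
  exact: le_trans xm (ltW mt).
apply: closedI; first exact: supp_closed.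
apply: (@closed_comp _ _ (Num.norm : V -> R) [set r | r <= m%:R]) => [y _|].
  exact: norm_continuous.
exact: closed_le.
Qed.

Lemma measure_csupp mu : mu (csupp mu) = 1%E.
Proof.
apply: prob1S (@supp_csupp mu) (@measure_supp mu).
  by apply: measurable_closed; exact: supp_closed.
exact: measurable_csupp.
Qed.

Lemma csupp_sub_closed mu C : closed C -> @convex_set R V C ->
  csupp mu `<=` C <-> mu C = 1%E.
Proof.
move=> cC vC; split=> [CC|C1].
  exact: prob1S (measurable_csupp mu) (measurable_closed cC) CC (measure_csupp mu).
by apply: smallest_sub => // x; apply.
Qed.

Lemma halfspace_convex a b : @convex_set R V [set x | dot a x <= b].
Proof.
apply/convexP => x y t /andP[t0 t1] /= ax ay; rewrite dot_lpoint; nra.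
Qed.

Lemma csupp_halfspace mu a b :
  csupp mu `<=` [set x | dot a x <= b] <-> mu [set x | dot a x <= b] = 1%E.
Proof. by apply: csupp_sub_closed; [exact: closed_dot_le|exact: halfspace_convex]. Qed.

End Support.

(** * Faces of the domain of the rate function *)

Section ExposedFaces.
Context {R : realType} {d : nat}.
Local Notation V := 'rV[R]_d.
Local Notation B := (borel_rV R d).
Local Notation law := (probability (borel_rV R d) R).
Local Notation hyp a b := [set x | dot a x = b].
Local Notation half a b := [set x | dot a x <= b].
Implicit Types (mu : law) (A C D F L : set V) (u v w a g h n x y z : V) (b c s t : R).

Lemma hyperplaneE a b : hyp a b = half a b `&` half (- a) (- b).
Proof.
apply/seteqP; split=> x /=; rewrite dotNl lerN2; first by move=> ->.
by move=> [ab ba]; apply/eqP; rewrite eq_le ab.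
Qed.

Lemma hyperplane_convex a b : @convex_set R V (hyp a b).
Proof. by apply/convexP => x y t _ /= ax ay; rewrite dot_lpoint ax ay; ring. Qed.

Lemma prob1_sub_hyperplane mu a b :
  mu (hyp a b) = 1%E -> mu (half a b) = 1%E /\ mu (half (- a) (- b)) = 1%E.
Proof.
move=> H; split; apply: prob1S H; try exact: measurable_hyperplane;
  try exact: measurable_halfspace; by rewrite hyperplaneE => x [].
Qed.

Lemma hyperplane_edom_rate mu a b :
  edom (rate mu) `<=` hyp a b <-> mu (hyp a b) = 1%E.
Proof.
split=> [EL|/prob1_sub_hyperplane[/halfspace_edom_rate h1 /halfspace_edom_rate h2] x Ex].
  have /halfspace_edom_rate h1 : edom (rate mu) `<=` half a b by rewrite hyperplaneE in EL;
    move=> x /EL[].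
  have /halfspace_edom_rate h2 : edom (rate mu) `<=` half (- a)
    (- b) by rewrite hyperplaneE in EL; move=> x /EL[].
  by rewrite hyperplaneE prob1I//; exact: measurable_halfspace.
by rewrite hyperplaneE; split; [exact: h1|exact: h2].
Qed.

Lemma csupp_hyperplane mu a b : csupp mu `<=` hyp a b <-> mu (hyp a b) = 1%E.
Proof. by apply: csupp_sub_closed; [exact: closed_dot_eq|exact: hyperplane_convex]. Qed.

Lemma cond_law_prob1 mu A U : measurable (A : set B) -> measurable (U : set B) ->
  (0 < mu A)%E -> mu (U `&` A) = mu A -> cond_law mu A U = 1%E.
Proof.
move=> mA mU A0 UA; have := @cond_lawE _ _ mu A U mA A0; rewrite UA => ->.
have f0 : 0 < fine (mu A) by rewrite -lte_fin -(prob_fin mu mA).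
by rewrite {1}(prob_fin mu mA) -EFinM divff// gt_eqF.
Qed.

(** A proper face lies in the proper exposed face cut out by its supporting hyperplane; maximality
    makes the two equal. *)
Lemma max_face_exposed C F : @convex_set R V C -> max_faces C F ->
  exists a b, [/\ F = C `&` hyp a b, C `<=` half a b & exists2 w, C w & dot a w < b].
Proof.
move=> vC [[[fF F0] FC] Fmax]; have [a [b [FL Cb [w Cw wb]]]] := face_support vC fF F0 FC.
exists a, b; split=> //; last by exists w.
have FsubC : F `<=` C by case: fF.
apply: contrapT => FneCL; apply: (Fmax (C `&` hyp a b)); last first.
  by move=> x Fx; split; [exact: FsubC|exact: FL].
split; first split.
- exact: support_face.
- by have [x Fx] := F0; exists x; split; [exact: FsubC|exact: FL].
- case=> [CL|CL]; last exact: FneCL.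
  have : (C `&` hyp a b) w by rewrite CL.
  by case=> _ /= wE; rewrite wE ltxx in wb.
Qed.

Definition charged_support mu a b :=
  mu (half a b) = 1%E /\ (0 < mu (hyp a b) < 1)%E.

Lemma prob_lt1 mu A : measurable (A : set B) -> mu A <> 1%E -> (mu A < 1)%E.
Proof. by move=> mA A1; rewrite lt_neqAle probability_le1// andbT; apply/eqP. Qed.

Lemma pos_max_face mu C : pos_max_faces mu C ->
  exists a b, [/\ charged_support mu a b, C = csupp mu `&` hyp a b,
    measurable (C : set B), (0 < mu C)%E & mu C = mu (hyp a b)].
Proof.
move=> [mC C0]; have [a [b [CE Cb [w Cw wb]]]] := max_face_exposed (@csupp_convex _ _ mu) mC.
have mL := measurable_hyperplane a b.
have ms := measurable_csupp mu.
have E : mu C = mu (hyp a b) by rewrite CE setIC prob1I//; exact: measure_csupp.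
exists a, b; split=> //; last by rewrite CE; exact: measurableI.
split; first exact/csupp_halfspace.
rewrite -E C0 E; apply: prob_lt1 => // /csupp_hyperplane/(_ _ Cw) /= wE.
by rewrite wE ltxx in wb.
Qed.

(** The hyperplane meets [csupp mu] in a face that is nonempty and proper because its probability
    lies strictly between 0 and 1; a maximal face above it has at least that probability. *)
Lemma charged_face_above mu a b : charged_support mu a b ->
  exists2 C, pos_max_faces mu C & csupp mu `&` hyp a b `<=` C.
Proof.
move=> [H1 /andP[L0 L1]]; have ms := measurable_csupp mu; have mL := measurable_hyperplane a b.
have E : mu (csupp mu `&` hyp a b) = mu (hyp a b).
  by rewrite setIC prob1I//; exact: measure_csupp.
have [|G mG GF] := @max_face_exists _ _ (csupp mu) (csupp mu `&` hyp a b) (@csupp_convex _ _ mu).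
  split; first split.
  - by apply: support_face; [exact: csupp_convex|exact/csupp_halfspace].
  - apply: contrapT => /set0P/negP/negPn/eqP F0; move: L0.
    by rewrite -E F0 measure0 ltxx.
  - move=> CL; have /csupp_hyperplane L1' : csupp mu `<=` hyp a b by rewrite -CL => x [].
    by rewrite L1' ltxx in L1.
exists G => //; split=> //; apply: lt_le_trans L0 _; rewrite -E.
apply: le_measure => //; rewrite inE; first exact: measurableI.
have [a' [b' [-> _ _]]] := max_face_exposed (@csupp_convex _ _ mu) mG.
by apply: measurableI => //; exact: measurable_hyperplane.
Qed.

Lemma supporting_hyperplaneP mu L : supporting_hyperplane (csupp mu) L ->
  exists a b, [/\ a != 0, L = hyp a b & mu (half a b) = 1%E].
Proof.
move=> [a [b [a0 -> _ [Cab|Cab]]]].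
  by exists a, b; split=> //; exact/csupp_halfspace.
exists (- a), (- b); split; first by rewrite oppr_eq0.
  by apply/seteqP; split=> x /=; rewrite dotNl; [move=> ->|move=> /oppr_inj].
by apply/csupp_halfspace => x /Cab /=; rewrite dotNl lerN2.
Qed.

Lemma charged_supporting_hyperplane mu a b : charged_support mu a b ->
  a != 0 /\ supporting_hyperplane (csupp mu) (hyp a b).
Proof.
move=> [H1 /andP[L0 L1]]; have a0 : a != 0.
  apply/eqP => a0; have [b0|b0] := eqVneq b 0.
    have LT : hyp a b = setT by apply/seteqP; split=> // x _; rewrite /= a0 dot0l b0.
    by move: L1; rewrite LT (_ : mu setT = 1%E) ?ltxx//; exact: probability_setT.
  have LT : hyp a b = set0.
    by apply/seteqP; split=> // x /=; rewrite a0 dot0l => /esym/eqP; rewrite (negbTE b0).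
  by move: L0; rewrite LT measure0 ltxx.
split=> //; exists a, b; split=> //; last by left; exact/csupp_halfspace.
apply: contrapT => /set0P/negP/negPn/eqP F0; move: L0.
rewrite -(@prob1I _ _ mu (hyp a b) (csupp mu)) ?F0 ?measure0 ?ltxx//.
- exact: measurable_hyperplane.
- exact: measurable_csupp.
- exact: measure_csupp.
Qed.

Lemma orth_projE a b x : a != 0 ->
  orth_proj (hyp a b) x = x - ((dot a x - b) / dot a a) *: a.
Proof.
move=> a0; have aa : dot a a != 0 by rewrite dot_eq0.
have [p0 p0E] : exists p0, p0 = x - ((dot a x - b) / dot a a) *: a by eexists.
have xp0 : x - p0 = ((dot a x - b) / dot a a) *: a by rewrite p0E opprB addrCA subrr addr0.
have Lp0 : dot a p0 = b by rewrite p0E dotBr dotZr divfK// opprB addrCA subrr addr0.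
have Pp0 : [set p | hyp a b p /\ forall q, hyp a b q -> dot (x - p) (q - p) = 0] p0.
  by split=> // q /= Lq; rewrite xp0 dotZl dotBr Lq Lp0 subrr mulr0.
rewrite -p0E /orth_proj; case: xgetP => [p _ [/= Lp orth]|/(_ _ Pp0)//].
have d0 : dot a (p0 - p) = 0 by rewrite dotBr Lp0 Lp subrr.
have := orth _ Lp0; rewrite (_ : x - p = (x - p0) + (p0 - p)); last by rewrite addrA subrK.
by rewrite dotDl xp0 dotZl d0 mulr0 add0r => /eqP; rewrite dot_eq0 subr_eq0 => /eqP.
Qed.

(** Turns equality of projections into a translation along [a], the form used in the duality
    lemmas. *)
Lemma orth_proj_eq a b x y : a != 0 ->
  orth_proj (hyp a b) x = orth_proj (hyp a b) y <-> exists t, y = x + t *: a.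
Proof.
move=> a0; have aa : dot a a != 0 by rewrite dot_eq0.
rewrite !orth_projE//; split=> [E|[t ->]].
  exists ((dot a y - b) / dot a a - (dot a x - b) / dot a a).
  by rewrite scalerBl addrCA E addrC subrK.
by rewrite dotDr dotZr; apply/rowP => j; rewrite !mxE; field.
Qed.

Lemma cond_law_edom_ae mu A C : measurable (A : set B) -> measurable (C : set B) ->
  C `<=` A -> mu C = mu A -> (0 < mu C)%E ->
  edom (cgf (cond_law mu C)) = edom (cgf (cond_law mu A)).
Proof.
move=> mA mC CA E C0; have A0 : (0 < mu A)%E by rewrite -E.
apply/seteqP; split=> u /cond_law_edom H; apply/cond_law_edom => //.
  by rewrite (mgf_ae u mA mC CA E); exact: H.
by rewrite -(mgf_ae u mA mC CA E); exact: H.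
Qed.

Lemma edom_rate_cond_sub mu a b A : measurable (A : set B) -> (0 < mu A)%E ->
  A `<=` hyp a b -> edom (rate (cond_law mu A)) `<=` hyp a b.
Proof.
move=> mA A0 AL; apply/hyperplane_edom_rate.
apply: cond_law_prob1 => //; first exact: measurable_hyperplane.
by rewrite setIC (setIidl AL).
Qed.

(** The projection condition moves every relative interior point of the conditioned domain along [a]
    into the domain of [cgf mu]. By [conjugate_of_projection] the restricted supremum of [rate_face]
    is then the full rate function of the conditioned law, up to the constant [ln (fine (mu A))]. *)
Lemma rate_on_charged_face mu a b A : hyperplane_projection mu -> charged_support mu a b ->
  measurable (A : set B) -> A `<=` hyp a b -> mu A = mu (hyp a b) ->
  edom (rate (cond_law mu A)) = edom (rate mu) `&` hyp a b /\
  forall v, edom (rate (cond_law mu A)) v ->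
    fine (rate mu v) = fine (rate (cond_law mu A) v) - ln (fine (mu A)).
Proof.
move=> proj cs mA AL E; have [a0 sL] := charged_supporting_hyperplane cs.
have [H1 L01] := cs; have A0 : (0 < mu A)%E by rewrite E; case/andP: L01.
have mL := measurable_hyperplane a b.
have DE := cond_law_edom_ae mL mA AL E A0.
have shift u t := @cond_law_shift _ _ mu A a b u t mA A0 AL.
have projD u : rint (edom (cgf (cond_law mu A))) u -> exists t, edom (cgf mu) (u + t *: a).
  move=> ru; have : (orth_proj (hyp a b) @` rint (edom (cgf (cond_law mu (hyp a b)))))
    (orth_proj (hyp a b) u).
    by exists u; rewrite -?DE.
  rewrite -(proj _ sL L01) => -[u' /rint_sub Du' /esym/orth_proj_eq-/(_ a0)[t u'E]].
  by exists t; rewrite -u'E.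
have key := conjugate_of_projection (@cgf_convex _ _ (cond_law mu A)) (edom_cond_law mA A0)
  shift (rate_face H1 mA AL E A0) projD.
have iff v c : dot a v = b -> (edom (rate mu) v /\ fine (rate mu v) <= c) <->
    (edom (rate (cond_law mu A)) v /\ fine (rate (cond_law mu A) v) <= c + ln (fine (mu A))).
  move=> av; rewrite (key v av c); symmetry; exact: (@rate_conjugate _ _ (cond_law mu A)).
have EL := edom_rate_cond_sub mA A0 AL.
split.
  apply/seteqP; split=> v.
    move=> Ev; have av := EL _ Ev; split=> //.
    have [] := (iff v (fine (rate (cond_law mu A) v) - ln (fine (mu A))) av).2; last by [].
    by rewrite subrK.
  by move=> [Ev av]; have [] := (iff v (fine (rate mu v)) av).1.
move=> v Ev; have av := EL _ Ev; apply/eqP; rewrite eq_le; apply/andP; split.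
  by have [|] := (iff v (fine (rate (cond_law mu A) v) - ln (fine (mu A))) av).2; rewrite ?subrK.
have [|Emv _] := (iff v (fine (rate (cond_law mu A) v) - ln (fine (mu A))) av).2;
  first by rewrite subrK.
by have [|_] := (iff v (fine (rate mu v)) av).1; rewrite // lerBlDr.
Qed.

Lemma rate_face_face mu C : hyperplane_projection mu -> pos_max_faces mu C ->
  (faces (edom (rate mu)) `\ edom (rate mu)) (edom (rate (cond_law mu C))).
Proof.
move=> proj /pos_max_face[a [b [cs CE mC C0 E]]].
have CL : C `<=` hyp a b by rewrite CE => x [].
have [-> _] := rate_on_charged_face proj cs mC CL E.
have [H1 /andP[L0 L1]] := cs.
split; first split.
- apply: support_face; first exact: convex_on_set (@rate_convex _ _ mu).
  exact/halfspace_edom_rate.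
- have [<- _] := rate_on_charged_face proj cs mC CL E; exact: edom_rate_nonempty.
- move=> EL; have /hyperplane_edom_rate L1' : edom (rate mu) `<=` hyp a b by rewrite -EL => x [].
  by rewrite L1' ltxx in L1.
Qed.

Lemma charged_support_rate mu a b v w : edom (rate mu) `<=` half a b ->
  edom (rate mu) v -> dot a v = b -> edom (rate mu) w -> dot a w < b -> charged_support mu a b.
Proof.
move=> /halfspace_edom_rate H1 Ev av Ew wb; split=> //; apply/andP; split.
  rewrite lt_def measure_ge0 andbT; apply/eqP => L0.
  exact: rate_null_face H1 L0 av Ev.
apply: prob_lt1; first exact: measurable_hyperplane.
by move=> /hyperplane_edom_rate/(_ _ Ew) /= wE; rewrite wE ltxx in wb.
Qed.

Lemma rate_face_above mu a b : hyperplane_projection mu -> charged_support mu a b ->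
  exists2 C, pos_max_faces mu C & edom (rate mu) `&` hyp a b `<=` edom (rate (cond_law mu C)).
Proof.
move=> proj cs; have [C pC CL] := charged_face_above cs; exists C => //.
have [a' [b' [cs' CE mC C0 E]]] := pos_max_face pC.
have CL' : C `<=` hyp a' b' by rewrite CE => x [].
have [-> _] := rate_on_charged_face proj cs' mC CL' E.
move=> v [Ev av]; split=> //.
have mL := measurable_hyperplane a b; have mL' := measurable_hyperplane a' b'.
have [EL _] := rate_on_charged_face proj cs mL (@subset_refl _ _) erefl.
have : edom (rate (cond_law mu (hyp a b))) v by rewrite EL.
have L0 : (0 < mu (hyp a b))%E by case: cs => _ /andP[].
(* Almost all of [hyp a b] lies in [C], hence in [hyp a' b']; so the law conditioned on [hyp a b] is
   carried by [hyp a' b'], and the domain of its rate function lies there. *)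
move: v {Ev av}; apply/hyperplane_edom_rate; apply: cond_law_prob1 => //.
apply/eqP; rewrite eq_le; apply/andP; split.
  by apply: le_measure; rewrite ?inE//; exact: measurableI.
have ms := measurable_csupp mu.
rewrite -(prob1I mL ms (measure_csupp mu)).
apply: le_measure; rewrite ?inE//; [exact: measurableI|exact: measurableI|].
by move=> x [Lx Cx]; split=> //; apply: CL'; apply: CL.
Qed.

Lemma max_faces_rate mu : hyperplane_projection mu ->
  max_faces (edom (rate mu)) `<=` [set edom (rate (cond_law mu C)) | C in pos_max_faces mu].
Proof.
move=> proj F mF; have vE := convex_on_set (@rate_convex _ _ mu).
have [a [b [FE Eb [w Ew wb]]]] := max_face_exposed vE mF.
have [[[_ [v Fv]] _] Fmax] := mF.
have [Ev av] : (edom (rate mu) `&` hyp a b) v by rewrite -FE.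
have cs := charged_support_rate Eb Ev av Ew wb.
have [C pC FC] := rate_face_above proj cs; exists C => //.
apply: contrapT => CF; apply: (Fmax (edom (rate (cond_law mu C)))); last by rewrite FE.
have [fC neC] := rate_face_face proj pC.
by split=> // -[].
Qed.

End ExposedFaces.

(** * Strict convexity *)

Section StrictConvexity.
Context {R : realType} {d : nat}.
Local Notation V := 'rV[R]_d.
Local Notation B := (borel_rV R d).
Local Notation law := (probability (borel_rV R d) R).
Local Notation hyp a b := [set x | dot a x = b].
Local Notation half a b := [set x | dot a x <= b].
Implicit Types (mu : law) (A C D F L : set V) (u v w a g h n x y z : V) (b c s t : R).

Lemma rate_fin mu v : edom (rate mu) v -> rate mu v = (fine (rate mu v))%:E.
Proof.
move=> Ev; rewrite fineK// ge0_fin_numE//.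
by apply: ereal_sup_ubound; exists 0 => //; have [D0 k0] := edom_cgf0 mu;
  rewrite cgf_fin// k0 dot0l sube0.
Qed.

Lemma strictly_convexP mu :
  strictly_convex (rate mu) <-> strictly_convex_on (edom (rate mu)) (fine \o rate mu).
Proof.
split=> sc x y xy E.
  move=> aff; apply: (sc x y xy); first by move=> _ [t + <-]; rewrite /= in_itv; exact: E.
  have Ex : edom (rate mu) x by rewrite -(lpoint0 x y); apply: E; rewrite lexx ler01.
  have Ey : edom (rate mu) y by rewrite -(lpoint1 x y); apply: E; rewrite lexx ler01.
  move=> t t01; rewrite (rate_fin (E _ t01)) (rate_fin Ex) (rate_fin Ey).
  by rewrite -!EFinM -EFinD; congr EFin; exact: aff.
have Et t : 0 <= t <= 1 -> edom (rate mu) (lpoint x y t).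
  by move=> t01; apply: E; exists t => //; rewrite /= in_itv.
move=> aff; apply: (sc x y xy Et) => t t01 /=; rewrite (aff _ t01).
have Ex : edom (rate mu) x by rewrite -(lpoint0 x y); apply: Et; rewrite lexx ler01.
have Ey : edom (rate mu) y by rewrite -(lpoint1 x y); apply: Et; rewrite lexx ler01.
by rewrite (rate_fin Ex) (rate_fin Ey) -!EFinM -EFinD.
Qed.

(** At a boundary point with a subgradient, the gradients along a segment coming from the interior
    stay bounded by [subgradient_bound], against steepness. *)
Lemma steep_boundary_subgradient mu u x : steep mu -> (edom (cgf mu))° !=set0 ->
  edom (cgf mu) u -> subgradient (edom (cgf mu)) (fine \o cgf mu) u x -> (edom (cgf mu))° u.
Proof.
move=> st [w0 Dw0] Du sx; apply: contrapT => nDu.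
have kc := @cgf_convex _ _ mu; have vD := convex_on_set kc.
have [b bP] := subgradient_bound kc Dw0 Du sx.
pose un (n : nat) := lpoint u w0 n.+1%:R^-1.
have t01 (n : nat) : 0 < (n.+1%:R^-1 : R) <= 1 by rewrite invr_gt0 ltr0n/= invf_le1// ler1n.
have Dun (n : nat) : (edom (cgf mu))° (un n) by exact: interior_lpoint.
have un_lim : un @ \oo --> u.
  have cl : {for (0 : R), continuous (fun t : R => lpoint u w0 t)}.
    apply: (@lpoint_continuous _ _ _ (cst u) (cst w0) id); [exact: cst_continuous..|].
    exact: cvg_id.
  rewrite -[X in _ --> X](lpoint0 u w0).
  exact: (cvg_comp _ _ (@cvg_harmonic R) cl).
have bu : boundary (edom (cgf mu)) u by split=> //; exact: subset_closure.
have := st un u Dun bu un_lim => /cvgryPgt/(_ b) [N _ /(_ N (leqnn N))] /=.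
have [g sg] := interior_subgradient kc (Dun N).
rewrite (grad_cgf (Dun N) sg) ltNge => /negP; apply; exact: bP (t01 N) sg.
Qed.

Lemma strictly_convex_of_steep mu : projection_property mu -> (edom (cgf mu))° !=set0 ->
  totally_steep mu -> strictly_convex_on (edom (rate mu)) (fine \o rate mu).
Proof.
move=> pp; elim: pp => {}mu proj _ IH D0 [st ts] x y xy Et aff.
have [Ex Ey] : edom (rate mu) x /\ edom (rate mu) y.
  by rewrite -(lpoint0 x y) -{2}(lpoint1 x y); split; apply: Et; rewrite lexx ler01.
have half01 : 0 <= (2^-1 : R) <= 1 by lra.
have Em := Et _ half01; set m := lpoint x y 2^-1 in Em.
have cj := @rate_conjugate _ _ mu; have cj' := @cgf_conjugate _ _ mu.
case: (subgradient_or_support (@rate_convex _ _ mu) Em) => [[u su]|[a [aE [w Ew wm]]]].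
  have [Du sx sy] := subgradient_of_midpoint cj cj' Ex Ey Em (aff _ half01) su.
  have Du' := steep_boundary_subgradient st D0 Du sx.
  by move: xy; rewrite -(grad_cgf Du' sx) -(grad_cgf Du' sy) eqxx.
have cs := charged_support_rate aE Em erefl Ew wm.
(* A linear form whose maximum over the domain is reached at the midpoint is constant on the
   segment, so the segment lies in the supporting hyperplane. *)
have [ax ay] : dot a x = dot a m /\ dot a y = dot a m.
  by have := aE _ Ex; have := aE _ Ey; rewrite /m !dot_lpoint; split; lra.
have [C pC EC] := rate_face_above proj cs.
have [a' [b' [cs' CE mC C0 E']]] := pos_max_face pC.
have CL' : C `<=` hyp a' b' by rewrite CE => z [].
have [_ iC] := rate_on_charged_face proj cs' mC CL' E'.
have Et' t : 0 <= t <= 1 -> edom (rate (cond_law mu C)) (lpoint x y t).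
  by move=> t01; apply: EC; split; [exact: Et|rewrite /= dot_lpoint ax ay; ring].
have ExC : edom (rate (cond_law mu C)) x by apply: EC.
have EyC : edom (rate (cond_law mu C)) y by apply: EC.
have DC0 : (edom (cgf (cond_law mu C)))° !=set0.
  have [w0 Dw0] := D0; exists w0.
  exact: (topology_structure.interiorS (edom_cond_law mC C0)) Dw0.
apply: (IH C pC DC0 (ts C pC) x y xy Et') => t t01.
have := aff _ t01; rewrite /= (iC _ (Et' _ t01)) (iC _ ExC) (iC _ EyC); lra.
Qed.

(** Conditioning enlarges the domain of the cumulant generating function, which gives one inclusion;
    [affine_projection] gives the other. *)
Lemma strictly_convex_projection mu :
  strictly_convex_on (edom (rate mu)) (fine \o rate mu) -> (edom (cgf mu))° !=set0 ->
  hyperplane_projection mu.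
Proof.
move=> sc D0 L /supporting_hyperplaneP[a [b [a0 -> H1]]] L01.
have mL := measurable_hyperplane a b; have L0 : (0 < mu (hyp a b))%E by case/andP: L01.
have DDL := edom_cond_law mL L0.
have DL0 : (edom (cgf (cond_law mu (hyp a b))))° !=set0.
  by have [w0 Dw0] := D0; exists w0; exact: (topology_structure.interiorS DDL) Dw0.
rewrite !rint_interior//; apply/seteqP; split=> _ [u Du <-].
  by exists u => //; exact: (topology_structure.interiorS DDL) Du.
have shift u' t := @cond_law_shift _ _ mu (hyp a b) a b u' t mL L0 (@subset_refl _ _).
have face := rate_face H1 mL (@subset_refl _ _) erefl L0.
have [t Dt] := affine_projection (@cgf_convex _ _ mu) (@cgf_convex _ _ (cond_law mu (hyp a b)))
  DDL shift face sc D0 Du.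
exists (u + t *: a) => //; apply/(orth_proj_eq _ _ _ a0); exists (- t).
by rewrite scaleNr addrK.
Qed.

(** If the gradients do not tend to infinity, some of them stay bounded arbitrarily far along the
    sequence, and [subgradient_cluster] yields a subgradient at the boundary point [p]. *)
Lemma strictly_convex_steep mu :
  strictly_convex_on (edom (rate mu)) (fine \o rate mu) -> (edom (cgf mu))° !=set0 ->
  steep mu.
Proof.
move=> sc D0 u p Du [cp ip] up; apply: contrapT => nlim.
have kc := @cgf_convex _ _ mu; have vD := convex_on_set kc.
have cj := @rate_conjugate _ _ mu; have cj' := @cgf_conjugate _ _ mu.
have /choice[g sg] : forall j, exists g, subgradient (edom (cgf mu)) (fine \o cgf mu) (u j) g.
  by move=> j; exact: interior_subgradient.
have gE j : grad (fine \o cgf mu) (u j) = g j by exact: grad_cgf.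
have [b bP] : exists b, forall N, exists j, (N <= j)%N /\ enorm (g j) <= b.
  apply: contrapT => H; apply: nlim; apply/cvgryPgt => b.
  have [N NP] : exists N, forall j, (N <= j)%N -> b < enorm (g j).
    apply: contrapT => H'; apply: H; exists b => N; apply: contrapT => H''; apply: H'.
    exists N => j Nj; rewrite ltNge; apply/negP => jb; apply: H''; by exists j.
  by exists N => // j Nj; rewrite /= gE; exact: NP.
have D0' : edom (cgf mu) !=set0 by have [w /interior_subset Dw] := D0; exists w.
have [g0 Dp sg0] := subgradient_cluster cj cj' D0' (fun j => interior_subset (Du j)) sg up bP.
have [n n0 nD] := normal_vector vD D0 ip.
apply: (@strictly_convex_ray _ _ _ _ g0 n (dot g0 p - fine (cgf mu p))
  (dot n p) sc n0) => s /andP[s0 s1].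
(* Adding a nonnegative multiple of the outer normal keeps a subgradient at [p], and on the
   subgradients at [p] the rate function is affine. *)
have [|Es ->] := conjugate_subgradient cj Dp (g := g0 + s *: n).
  move=> w Dw; have := sg0 _ Dw; have := ler_wpM2l s0 (nD _ Dw).
  by rewrite dotDl dotZl !dotBr; lra.
split=> //; rewrite dotDr dotZr !(dotC p) /=; ring.
Qed.

Lemma strictly_convex_cond_law mu C : hyperplane_projection mu ->
  strictly_convex_on (edom (rate mu)) (fine \o rate mu) -> pos_max_faces mu C ->
  strictly_convex_on (edom (rate (cond_law mu C))) (fine \o rate (cond_law mu C)).
Proof.
move=> proj sc /pos_max_face[a [b [cs CE mC C0 E]]] x y xy Et aff.
have CL : C `<=` hyp a b by rewrite CE => z [].
have [EC iC] := rate_on_charged_face proj cs mC CL E.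
have Ex : edom (rate (cond_law mu C)) x by rewrite -(lpoint0 x y); apply: Et; rewrite lexx ler01.
have Ey : edom (rate (cond_law mu C)) y by rewrite -(lpoint1 x y); apply: Et; rewrite lexx ler01.
apply: (sc x y xy) => t t01; first by have := Et _ t01; rewrite EC => -[].
have := aff _ t01; rewrite /= (iC _ (Et _ t01)) (iC _ Ex) (iC _ Ey); lra.
Qed.

Lemma strictly_convex_interior_cgf mu :
  strictly_convex_on (edom (rate mu)) (fine \o rate mu) -> (edom (cgf mu))° !=set0.
Proof.
apply: strictly_convex_interior.
- exact: convex_on_set (@cgf_convex _ _ mu).
- by exists 0; have [] := edom_cgf0 mu.
- exact: edom_rate_nonempty.
- exact: rate_conjugate.
Qed.

Lemma prob1_row_combination mu m (M : 'M[R]_(m, d)) a :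
  (forall j, exists b, mu (hyp (row j M) b) = 1%E) -> (a <= M)%MS ->
  exists b, mu (hyp a b) = 1%E.
Proof.
move=> /choice[beta M1] /submxP[c ->]; exists (\sum_j c ord0 j * beta j).
apply/csupp_hyperplane => x Cx /=.
rewrite /dot (eq_bigr (fun i => \sum_j c ord0 j * M j i * x ord0 i)) => [|i _]; last first.
  by rewrite mxE mulr_suml.
rewrite exchange_big; apply: eq_bigr => j _ /=.
have /csupp_hyperplane/(_ _ Cx) /= <- := M1 j.
rewrite /dot mulr_sumr; apply: eq_bigr => i _; rewrite !mxE; ring.
Qed.

(* Induction on the codimension of the affine hull of the support: the rows of
   [M] are independent linear forms that are almost surely constant. *)
Lemma steep_of_strictly_convex mu : strictly_convex_on (edom (rate mu)) (fine \o rate mu) ->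
  projection_property mu /\ totally_steep mu.
Proof.
suff main k m (M : 'M[R]_(m, d)) (nu : law) : (d - m < k)%N -> row_free M ->
    (forall j, exists b, nu (hyp (row j M) b) = 1%E) ->
    strictly_convex_on (edom (rate nu)) (fine \o rate nu) ->
    projection_property nu /\ totally_steep nu.
  apply: (main d.+1 0%N 0) => //; first by rewrite subn0.
    by rewrite /row_free mxrank0.
  by case.
elim: k m M nu => [|k IH] m M nu mk fM M1 sc; first by rewrite ltn0 in mk.
have D0 := strictly_convex_interior_cgf sc.
have proj := strictly_convex_projection sc D0.
have st := strictly_convex_steep sc D0.
suff rec C : pos_max_faces nu C -> projection_property (cond_law nu C) /\ totally_steep (cond_law nu C).
  split; first exact: ProjectionProperty proj (fun C' pC' => (rec C' pC').1).
  exact: TotallySteep st (fun C' pC' => (rec C' pC').2).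
move=> pC; have scC := strictly_convex_cond_law proj sc pC.
have [a [b [[H1 /andP[L0 L1]] CE mC C0 E]]] := pos_max_face pC.
have CL : C `<=` hyp a b by rewrite CE => z [].
(* Otherwise [dot a] would be almost surely constant, and the hyperplane would have probability 0 or
   1. *)
have aM : ~~ (a <= M)%MS.
  apply/negP => /(prob1_row_combination M1)[b' ab'].
  have mL' := measurable_hyperplane a b'; have mL := measurable_hyperplane a b.
  have [b'b|b'b] := eqVneq b' b; first by rewrite -b'b ab' ltxx in L1.
  have := prob1I mL mL' ab'; rewrite (_ : _ `&` _ = set0) ?measure0.
    by move=> L0'; rewrite -L0' ltxx in L0.
  apply/seteqP; split=> // z [/= -> /eqP]; by rewrite eq_sym (negbTE b'b).
have fM' := row_free_col_mx fM aM.
apply: (IH (m + 1)%N (col_mx M a)) => //.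
  have := rank_leq_col (col_mx M a); rewrite (eqP fM') addn1 => md.
  by rewrite subnS -ltnS prednK// subn_gt0.
move=> i; case: (split_ordP i) => j ->.
  have [c M1c] := M1 j; exists c; have mc := measurable_hyperplane (row j M) c.
  by rewrite rowKu; apply: cond_law_prob1 => //; rewrite setIC prob1I.
exists b; rewrite rowKd row_id; apply: cond_law_prob1 => //; first exact: measurable_hyperplane.
by rewrite setIC (setIidl CL).
Qed.

End StrictConvexity.

Theorem theorem2 (R : realType) (d : nat) (hd : (0 < d)%N)
    (disp : measure_display) (T : measurableType disp) (P : probability T R)
    (X : {RV P >-> borel_rV R d}) :
  let mu : probability (borel_rV R d) R := distribution P X in
  (hyperplane_projection mu ->
     max_faces (edom (rate mu)) `<=`
       [set edom (rate (cond_law mu C)) | C in pos_max_faces mu] /\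
     [set edom (rate (cond_law mu C)) | C in pos_max_faces mu] `<=`
       faces (edom (rate mu)) `\ edom (rate mu)) /\
  (strictly_convex (rate mu) <->
     [/\ (edom (cgf mu))° !=set0, projection_property mu & totally_steep mu]).
Proof.
move=> mu; split; [move=> proj; split|split].
- exact: max_faces_rate.
- by move=> _ [C pC <-]; exact: rate_face_face.
- move=> /strictly_convexP sc; have [pp ts] := steep_of_strictly_convex sc.
  by split=> //; exact: strictly_convex_interior_cgf.
- by move=> [D0 pp ts]; apply/strictly_convexP; exact: strictly_convex_of_steep.
Qed.
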